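(* Let $U$ be a complete length $\mathrm{CAT}(1)$ space. Assume there is a point $p\in U$ such that $|p-x|\le\tfrac\pi2$ for every $x\in U$. Then $U$ is $1$-complemented; that is, for some non-principal ultrafilter $\omega$ on $\mathbb{N}$ there exists a short retraction of the ultracompletion $U^\omega$ onto $U$.
   Context: For a non-principal ultrafilter $\omega$ on $\mathbb{N}$ and a bounded metric space $U$ (the space here has diameter at most $\pi$), the ultracompletion $U^\omega$ is the set of all sequences $(x_n)$ in $U$ modulo the relation $(x_n)\sim(y_n)$ iff $\lim_\omega |x_n-y_n|=0$, with metric $|(x_n)-(y_n)|=\lim_\omega|x_n-y_n|$; $U$ is regarded as a subset of $U^\omega$ via constant sequences. A short retraction of $U^\omega$ onto $U$ is a 1-Lipschitz map $U^\omega\to U$ that restricts to the identity on $U$. A metric space is $1$-complemented if for some non-principal ultrafilter $\omega$ there is a short retraction $U^\omega\to U$. *)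

(* Defs.v *)
From Stdlib Require Import Reals.
Open Scope R_scope.

Definition is_metric {X : Type} (d : X -> X -> R) : Prop :=
  (forall x y, 0 <= d x y) /\
  (forall x y, d x y = 0 <-> x = y) /\
  (forall x y, d x y = d y x) /\
  (forall x y z, d x z <= d x y + d y z).

Definition cauchy_seq {X : Type} (d : X -> X -> R) (u : nat -> X) : Prop :=
  forall eps, 0 < eps -> exists N, forall m n, (N <= m)%nat -> (N <= n)%nat ->
    d (u m) (u n) < eps.

Definition converges_to {X : Type} (d : X -> X -> R) (u : nat -> X) (l : X) : Prop :=
  forall eps, 0 < eps -> exists N, forall n, (N <= n)%nat -> d (u n) l < eps.

Definition complete {X : Type} (d : X -> X -> R) : Prop :=
  forall u, cauchy_seq d u -> exists l, converges_to d u l.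

Definition curve_continuous {X : Type} (d : X -> X -> R) (c : R -> X) : Prop :=
  forall s, 0 <= s <= 1 -> forall eps, 0 < eps -> exists delta, 0 < delta /\
    forall s', 0 <= s' <= 1 -> Rabs (s - s') < delta -> d (c s) (c s') < eps.

Definition partition01 (t : nat -> R) (n : nat) : Prop :=
  t O = 0 /\ t (S n) = 1 /\ (forall i, (i <= n)%nat -> t i <= t (S i)).

Definition length_le {X : Type} (d : X -> X -> R) (c : R -> X) (L : R) : Prop :=
  forall t n, partition01 t n ->
    sum_f_R0 (fun i => d (c (t i)) (c (t (S i)))) n <= L.

(* length space: the distance is the infimum of lengths of curves
   (curve lengths are always >= the distance, so it suffices to ask for
   curves of length <= d x y + eps for every eps > 0). *)
Definition length_space {X : Type} (d : X -> X -> R) : Prop :=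
  forall x y eps, 0 < eps -> exists c : R -> X,
    curve_continuous d c /\ c 0 = x /\ c 1 = y /\ length_le d c (d x y + eps).

Definition geodesic {X : Type} (d : X -> X -> R) (x y : X) (g : R -> X) : Prop :=
  g 0 = x /\ g (d x y) = y /\
  forall s t, 0 <= s <= d x y -> 0 <= t <= d x y -> d (g s) (g t) = Rabs (s - t).

Definition R3 := (R * R * R)%type.
Definition dot3 (u v : R3) : R :=
  let '(u1, u2, u3) := u in let '(v1, v2, v3) := v in u1 * v1 + u2 * v2 + u3 * v3.
Definition on_S2 (u : R3) : Prop := dot3 u u = 1.
Definition sdist (u v : R3) : R := acos (dot3 u v).

(** * CAT(1) (Bridson--Haefliger definition) *)
(* p lies on the side g (geodesic from x to y) at parameter t, and pt is the
   corresponding point on the side [ux,uy] of the comparison triangle *)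
Definition side_point {X : Type} (d : X -> X -> R) (x y : X) (g : R -> X)
    (ux uy : R3) (p : X) (pt : R3) : Prop :=
  exists t, 0 <= t <= d x y /\ p = g t /\
    on_S2 pt /\ sdist ux pt = t /\ sdist pt uy = d x y - t.

Definition CAT1 {X : Type} (d : X -> X -> R) : Prop :=
  (forall x y, d x y < PI -> exists g, geodesic d x y g) /\
  (forall x1 x2 x3 g12 g23 g31,
    geodesic d x1 x2 g12 -> geodesic d x2 x3 g23 -> geodesic d x3 x1 g31 ->
    d x1 x2 + d x2 x3 + d x3 x1 < 2 * PI ->
    forall u1 u2 u3 : R3, on_S2 u1 -> on_S2 u2 -> on_S2 u3 ->
      sdist u1 u2 = d x1 x2 -> sdist u2 u3 = d x2 x3 -> sdist u3 u1 = d x3 x1 ->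
      let on_tri := fun p pt =>
        side_point d x1 x2 g12 u1 u2 p pt \/
        side_point d x2 x3 g23 u2 u3 p pt \/
        side_point d x3 x1 g31 u3 u1 p pt in
      forall p q pt qt, on_tri p pt -> on_tri q qt -> d p q <= sdist pt qt).

Definition ultrafilter (w : (nat -> Prop) -> Prop) : Prop :=
  w (fun _ => True) /\
  ~ w (fun _ => False) /\
  (forall A B : nat -> Prop, (forall n, A n -> B n) -> w A -> w B) /\
  (forall A B : nat -> Prop, w A -> w B -> w (fun n => A n /\ B n)) /\
  (forall A : nat -> Prop, w A \/ w (fun n => ~ A n)).

Definition nonprincipal (w : (nat -> Prop) -> Prop) : Prop :=
  forall k : nat, ~ w (fun n => n = k).

Definition ulim (w : (nat -> Prop) -> Prop) (a : nat -> R) (L : R) : Prop :=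
  forall eps, 0 < eps -> w (fun n => Rabs (a n - L) < eps).

(** * Short retraction of the ultracompletion U^w onto U.
   A map U^w -> U is represented by a map f on sequences; the 1-Lipschitz
   condition |f x - f y| <= lim_w |x_n - y_n| forces f to be constant on
   ~-classes, so such f are exactly the short maps U^w -> U.  Restricting to
   the identity on U means f (constant sequence x) = x. *)
Definition short_retraction {X : Type} (d : X -> X -> R)
    (w : (nat -> Prop) -> Prop) (f : (nat -> X) -> X) : Prop :=
  (forall (x y : nat -> X) (L : R), ulim w (fun n => d (x n) (y n)) L ->
     d (f x) (f y) <= L) /\
  (forall x : X, f (fun _ => x) = x).

Definition one_complemented {X : Type} (d : X -> X -> R) : Prop :=
  exists w, ultrafilter w /\ nonprincipal w /\
    exists f : (nat -> X) -> X, short_retraction d w f.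

(* Main.v *)
Require Import Defs.
From Stdlib Require Import Reals Lra Lia Psatz Arith ClassicalEpsilon.
From mathcomp Require ssrnat filter.
Open Scope R_scope.

(* Let W be the ultracompletion of U.  Since U has diameter at most PI and is CAT(1),
   the Euclidean cone over W is complete and nonpositively curved, and the cone C
   over U is a complete convex subcone of it.  In such spaces nearest-point
   projections onto convex sets are short.  Consider the decreasing family of convex cones
     K_t = { v | a_t |v - C| <= b_t <v, p> },
   with a_t growing from 0 to 1 and then b_t decreasing from 1 to 0, so that K_0
   contains W (this uses |p - x| <= PI/2) and K_2 = C.  A unit vector of K_s lies within
   O(t - s) of K_t, and projecting onto a cone changes the norm only by a quadratic
   amount.  Hence projecting successively onto K_t along finer and finer
   subdivisions of [0, 2] converges to a short map which preserves unit vectors and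
   fixes C: it carries W to U and is the required retraction. *)

(** * Nonpositively curved pseudometric spaces *)

(** A single projection of W onto C is already short, but it can send a unit vector to the apex and
    so lose its direction. Projecting onto a cone lowers the squared norm by exactly the square of
    the step, so N steps of length O(1/N) lose only O(1/N) altogether; this is why C is approached
    through intermediate cones. The point p keeps their speed bounded: moving toward p pays for the
    growth of a_t, and once |v - C| <= <v, p> holds, moving toward the projection on C pays for the
    decay of b_t. The cone is not a vector space. What survives is a sum with <z, v + w> >= <z, v> +
    <z, w> and |v + w|^2 <= |v|^2 + |w|^2 + 2 <v, w>. Nonpositive curvature follows from these two
    inequalities by expanding squares, and both pass to limits along an ultrafilter, so sums over W
    are formed index by index. Bounded sequences are used without a quotient, hence pseudometrics
    and conclusions of the form [D v w = 0]. *)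

Lemma Rle_of_eps (a b c : R) : (forall e, 0 < e -> a <= b + e * c) -> a <= b.
Proof.
  intros H. destruct (Rle_or_lt a b) as [|Hab]; [assumption|].
  destruct (Rle_or_lt c 0) as [Hc|Hc].
  - specialize (H 1 Rlt_0_1). lra.
  - assert (He : 0 < (a - b) / (2 * c)) by (apply Rdiv_lt_0_compat; lra).
    specialize (H _ He).
    replace ((a - b) / (2 * c) * c) with ((a - b) / 2) in H by (field; lra). lra.
Qed.

Lemma le_of_sqr_le (a b : R) : 0 <= b -> a ^ 2 <= b ^ 2 -> a <= b.
Proof. intros Hb H. nra. Qed.

Lemma inv_INR_small (c e : R) : 0 < e ->
  exists N : nat, forall n, (N <= n)%nat -> c * / (INR n + 1) < e.
Proof.
  intros He. destruct (Rle_or_lt c 0) as [Hc|Hc].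
  - exists O. intros n _.
    assert (H := Rinv_0_lt_compat (INR n + 1)). pose proof (pos_INR n). nra.
  - destruct (INR_archimed e c He) as [N HN].
    exists N. intros n Hn. apply le_INR in Hn. pose proof (pos_INR n).
    apply Rmult_lt_reg_r with (INR n + 1); [lra|].
    rewrite Rmult_assoc, Rinv_l by lra. nra.
Qed.

Lemma INR_pow2 (m : nat) : INR (2 ^ m) = 2 ^ m.
Proof. rewrite pow_INR. reflexivity. Qed.

Lemma inv_pow2_le (m : nat) : / 2 ^ m <= / (INR m + 1).
Proof.
  apply Rinv_le_contravar; [pose proof (pos_INR m); lra|].
  induction m as [|m IH]; [simpl; lra|].
  rewrite S_INR. simpl. pose proof (pos_INR m). lra.
Qed.

Section NPC.

Variables (Y : Type) (D : Y -> Y -> R) (comb : R -> Y -> Y -> Y).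
Hypothesis D_ge0 : forall v w, 0 <= D v w.
Hypothesis D_sym : forall v w, D v w = D w v.
Hypothesis D_refl : forall v, D v v = 0.
Hypothesis D_tri : forall u v w, D u w <= D u v + D v w.
(** The CN inequality of Bruhat and Tits at an arbitrary ratio. Taking z = v and z = w, it already
    forces [comb t v w] to divide the segment in the ratio t. *)
Hypothesis comb_npc : forall t v w z, 0 <= t <= 1 ->
  D z (comb t v w) ^ 2
    <= (1 - t) * D z v ^ 2 + t * D z w ^ 2 - t * (1 - t) * D v w ^ 2.

Definition comb_convex (K : Y -> Prop) : Prop :=
  forall t v w, 0 <= t <= 1 -> K v -> K w -> K (comb t v w).

Definition complete_set (K : Y -> Prop) : Prop :=
  forall u, (forall n, K (u n)) -> cauchy_seq D u ->
    exists l, K l /\ converges_to D u l.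

(** The Pythagorean form of a nearest point: the angle at [P v] toward any point of K is at least a
    right angle. Minimality of the distance follows by dropping a square. *)
Definition is_projection (K : Y -> Prop) (P : Y -> Y) : Prop :=
  forall v, K (P v) /\
    forall z, K z -> D v (P v) ^ 2 + D (P v) z ^ 2 <= D v z ^ 2.

Lemma D_tri_weighted (t : R) (a b c : Y) : 0 < t < 1 ->
  D a c ^ 2 <= D a b ^ 2 / t + D b c ^ 2 / (1 - t).
Proof.
  intros Ht. pose proof (D_tri a b c) as H.
  assert (Hs : D a c ^ 2 <= (D a b + D b c) ^ 2).
  { apply pow_incr. split; [apply D_ge0|exact H]. }
  apply Rle_trans with (1 := Hs).
  assert (E : D a b ^ 2 / t + D b c ^ 2 / (1 - t) - (D a b + D b c) ^ 2
    = (D a b * (1 - t) - D b c * t) ^ 2 / (t * (1 - t))) by (field; lra).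
  assert (0 <= (D a b * (1 - t) - D b c * t) ^ 2 / (t * (1 - t))).
  { apply Rle_mult_inv_pos; [apply pow2_ge_0|nra]. }
  lra.
Qed.

(* Joining b and e through the point of [ac] at ratio |ab| : |ce| turns the
   weighted parallelogram inequality into Reshetnyak's one; eps keeps the
   ratio inside (0, 1) when a side degenerates. *)
Lemma quadrilateral (a b c e : Y) :
  D a c ^ 2 + D b e ^ 2 <= D b c ^ 2 + D e a ^ 2 + 2 * D a b * D c e.
Proof.
  apply Rle_of_eps with (c := D a b + D c e). intros eps He.
  set (A := D a b). set (C := D c e).
  assert (HA : 0 <= A) by apply D_ge0. assert (HC : 0 <= C) by apply D_ge0.
  set (t := (A + eps) / (A + C + 2 * eps)).
  assert (Ht1 : 1 - t = (C + eps) / (A + C + 2 * eps)) by (unfold t; field; lra).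
  assert (Ht : 0 < t < 1).
  { assert (0 < 1 - t) by (rewrite Ht1; apply Rdiv_lt_0_compat; lra).
    split; [apply Rdiv_lt_0_compat; lra|lra]. }
  pose proof (comb_npc t a c b ltac:(lra)) as Hb.
  pose proof (comb_npc t a c e ltac:(lra)) as He'.
  pose proof (D_tri_weighted t b (comb t a c) e Ht) as H.
  rewrite (D_sym (comb t a c) e) in H.
  rewrite (D_sym b a) in Hb. rewrite (D_sym e c) in He'. fold A in Hb. fold C in He'.
  assert (H1 : D b (comb t a c) ^ 2 / t <= (1 - t) / t * A ^ 2 + D b c ^ 2 - (1 - t) * D a c ^ 2).
  { apply Rmult_le_reg_r with t; [lra|]. unfold Rdiv at 1.
    rewrite Rmult_assoc, Rinv_l, Rmult_1_r by lra. apply Rle_trans with (1 := Hb).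
    right. field. lra. }
  assert (H2 : D e (comb t a c) ^ 2 / (1 - t) <= D e a ^ 2 + t / (1 - t) * C ^ 2 - t * D a c ^ 2).
  { apply Rmult_le_reg_r with (1 - t); [lra|]. unfold Rdiv at 1.
    rewrite Rmult_assoc, Rinv_l, Rmult_1_r by lra. apply Rle_trans with (1 := He').
    right. field. lra. }
  assert (H3 : (1 - t) / t * A ^ 2 <= (C + eps) * A).
  { replace ((1 - t) / t * A ^ 2) with ((C + eps) * A * (A / (A + eps))).
    - assert (A / (A + eps) <= 1).
      { apply Rmult_le_reg_r with (A + eps); [lra|]. unfold Rdiv.
        rewrite Rmult_assoc, Rinv_l by lra. lra. }
      assert (0 <= (C + eps) * A) by nra. nra.
    - rewrite Ht1. unfold t. field. lra. }
  assert (H4 : t / (1 - t) * C ^ 2 <= (A + eps) * C).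
  { replace (t / (1 - t) * C ^ 2) with ((A + eps) * C * (C / (C + eps))).
    - assert (C / (C + eps) <= 1).
      { apply Rmult_le_reg_r with (C + eps); [lra|]. unfold Rdiv.
        rewrite Rmult_assoc, Rinv_l by lra. lra. }
      assert (0 <= (A + eps) * C) by nra. nra.
    - rewrite Ht1. unfold t. field. lra. }
  lra.
Qed.

Lemma comb_dist_l (t : R) (v w : Y) : 0 <= t <= 1 -> D v (comb t v w) <= t * D v w.
Proof.
  intros Ht. apply le_of_sqr_le.
  - apply Rmult_le_pos; [lra|apply D_ge0].
  - pose proof (comb_npc t v w v Ht) as H. rewrite D_refl in H. nra.
Qed.

Lemma comb_dist_r (t : R) (v w : Y) : 0 <= t <= 1 -> D (comb t v w) w <= (1 - t) * D v w.
Proof.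
  intros Ht. apply le_of_sqr_le.
  - apply Rmult_le_pos; [lra|apply D_ge0].
  - pose proof (comb_npc t v w w Ht) as H. rewrite D_refl, (D_sym w v), D_sym in H. nra.
Qed.

(** [comb_npc] is used three times: [comb t v w] against the segment from v to w', then v and w'
    against the segment from v to w. Everything cancels except t^2 D w w'^2. *)
Lemma comb_dist_common_l (t : R) (v w w' : Y) : 0 <= t <= 1 ->
  D (comb t v w) (comb t v w') <= t * D w w'.
Proof.
  intros Ht. apply le_of_sqr_le.
  - apply Rmult_le_pos; [lra|apply D_ge0].
  - pose proof (comb_npc t v w' (comb t v w) Ht) as H1.
    pose proof (comb_npc t v w v Ht) as H2.
    pose proof (comb_npc t v w w' Ht) as H3.
    rewrite D_refl in H2. rewrite (D_sym (comb t v w) v), (D_sym (comb t v w) w') in H1.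
    rewrite (D_sym w' v), (D_sym w' w) in H3.
    apply (Rmult_le_compat_l (1 - t)) in H2; [|lra].
    apply (Rmult_le_compat_l t) in H3; [|lra].
    nra.
Qed.

Lemma comb_dist_common_r (t : R) (v v' w : Y) : 0 <= t <= 1 ->
  D (comb t v w) (comb t v' w) <= (1 - t) * D v v'.
Proof.
  intros Ht. apply le_of_sqr_le.
  - apply Rmult_le_pos; [lra|apply D_ge0].
  - pose proof (comb_npc t v' w (comb t v w) Ht) as H1.
    pose proof (comb_npc t v w w Ht) as H2.
    pose proof (comb_npc t v w v' Ht) as H3.
    rewrite D_refl in H2.
    rewrite (D_sym (comb t v w) v'), (D_sym (comb t v w) w) in H1.
    rewrite (D_sym w v) in H2. rewrite (D_sym v' v) in H3.
    apply (Rmult_le_compat_l t) in H2; [|lra].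
    apply (Rmult_le_compat_l (1 - t)) in H3; [|lra].
    nra.
Qed.

Lemma comb_dist (t : R) (v v' w w' : Y) : 0 <= t <= 1 ->
  D (comb t v w) (comb t v' w') <= (1 - t) * D v v' + t * D w w'.
Proof.
  intros Ht.
  pose proof (D_tri (comb t v w) (comb t v' w) (comb t v' w')).
  pose proof (comb_dist_common_r t v v' w Ht).
  pose proof (comb_dist_common_l t v' w w' Ht). lra.
Qed.

(** * Nearest-point projections onto complete convex sets *)

Lemma inf_exists (K : Y -> Prop) (f : Y -> R) : (exists z, K z) ->
  (forall z, 0 <= f z) ->
  exists m, (forall z, K z -> m <= f z) /\
    forall e, 0 < e -> exists z, K z /\ f z < m + e.
Proof.
  intros [z0 Hz0] Hf.
  destruct (completeness (fun r => exists z, K z /\ r = - f z)) as [s [Hs1 Hs2]].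
  - exists 0. intros r [z [_ ->]]. specialize (Hf z). lra.
  - exists (- f z0), z0. auto.
  - exists (- s). split.
    + intros z Hz. assert (- f z <= s) by (apply Hs1; exists z; auto). lra.
    + intros e He. apply NNPP. intros Hn.
      assert (s <= s - e); [|lra].
      apply Hs2. intros r [z [Hz ->]].
      destruct (Rlt_or_le (f z) (- s + e)) as [H|H]; [|lra].
      exfalso. apply Hn. exists z. auto.
Qed.

(** Midpoints of near-minimizers stay in K, so the CN inequality at ratio 1/2 makes a minimizing
    sequence Cauchy. The Pythagorean inequality is the first variation of the squared distance along
    the segment from the minimizer to z. *)
Lemma projection_exists (K : Y -> Prop) :
  (exists z, K z) -> comb_convex K -> complete_set K -> exists P, is_projection K P.
Proof.
  intros Hne Hconv Hcomp.
  assert (H : forall v, exists l, K l /\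
    forall z, K z -> D v l ^ 2 + D l z ^ 2 <= D v z ^ 2).
  { intros v.
    destruct (inf_exists K (fun z => D v z ^ 2) Hne) as [m [Hm1 Hm2]].
    { intros; apply pow2_ge_0. }
    assert (Hu : forall n, exists z, K z /\ D v z ^ 2 < m + / (INR n + 1)).
    { intros n. apply Hm2. apply Rinv_0_lt_compat. pose proof (pos_INR n). lra. }
    set (u := fun n => proj1_sig (constructive_indefinite_description _ (Hu n))).
    assert (Hu1 : forall n, K (u n)).
    { intros n. unfold u. destruct (constructive_indefinite_description _ (Hu n)) as [z []]. auto. }
    assert (Hu2 : forall n, D v (u n) ^ 2 < m + / (INR n + 1)).
    { intros n. unfold u. destruct (constructive_indefinite_description _ (Hu n)) as [z []]. auto. }
    destruct (Hcomp u Hu1) as [l [Hl1 Hl2]].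
    { intros e He. destruct (inv_INR_small 4 (e ^ 2)) as [N HN]; [nra|].
      exists N. intros i j Hi Hj.
      pose proof (HN i Hi). pose proof (HN j Hj).
      pose proof (Hm1 _ (Hconv (1/2) _ _ ltac:(lra) (Hu1 i) (Hu1 j))) as H1.
      pose proof (comb_npc (1/2) (u i) (u j) v ltac:(lra)) as H2.
      pose proof (Hu2 i). pose proof (Hu2 j).
      assert (D (u i) (u j) ^ 2 < e ^ 2) by lra.
      pose proof (D_ge0 (u i) (u j)). nra. }
    assert (Hlm : D v l ^ 2 <= m).
    { destruct (Rle_or_lt (D v l ^ 2) m) as [|Hlt]; [assumption|exfalso].
      set (g := D v l ^ 2 - m).
      assert (Hg : 0 < g) by (unfold g; lra).
      assert (Hc : 0 < 2 * D v l + 1) by (pose proof (D_ge0 v l); lra).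
      destruct (Hl2 (g / 2 / (2 * D v l + 1))) as [N1 HN1].
      { apply Rdiv_lt_0_compat; lra. }
      destruct (inv_INR_small 1 (g / 2)) as [N2 HN2]; [lra|].
      set (n := max N1 N2).
      specialize (HN1 n (Nat.le_max_l _ _)). specialize (HN2 n (Nat.le_max_r _ _)).
      pose proof (D_tri v (u n) l). pose proof (Hu2 n). rewrite Rmult_1_l in HN2.
      assert (D (u n) l * (2 * D v l + 1) < g / 2).
      { apply Rmult_lt_reg_r with (/ (2 * D v l + 1)); [apply Rinv_0_lt_compat; lra|].
        rewrite Rmult_assoc, Rinv_r by lra. rewrite Rmult_1_r. exact HN1. }
      pose proof (D_ge0 (u n) l). pose proof (D_ge0 v (u n)). pose proof (D_ge0 v l).
      unfold g in *.
      destruct (Rle_or_lt (D v l) (D v (u n))); nra. }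
    exists l. split; [exact Hl1|]. intros z Hz.
    apply Rle_of_eps with (c := D l z ^ 2). intros e He.
    (* For e < 1 the point [comb e l z] of K is no closer to v than l; dividing the CN inequality by
       e leaves an error e D l z^2. *)
    destruct (Rle_or_lt 1 e) as [Hge|Hlt].
    - pose proof (Hm1 _ Hz). pose proof (pow2_ge_0 (D l z)). cbv beta in *. nra.
    - pose proof (Hm1 _ (Hconv e _ _ ltac:(lra) Hl1 Hz)) as H1.
      pose proof (comb_npc e l z v ltac:(lra)) as H2. cbv beta in H1.
      apply Rmult_le_reg_l with e; [lra|]. nra. }
  exists (fun v => proj1_sig (constructive_indefinite_description _ (H v))).
  intros v. destruct (constructive_indefinite_description _ (H v)) as [l Hl]. exact Hl.
Qed.

(** Add the Pythagorean inequalities at [P v] and [P w] to Reshetnyak's inequality for v, w, [P w],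
    [P v]: all terms cancel but D (P v) (P w)^2 <= D v w * D (P v) (P w). *)
Lemma projection_short (K : Y -> Prop) (P : Y -> Y) : is_projection K P ->
  forall v w, D (P v) (P w) <= D v w.
Proof.
  intros HP v w.
  pose proof (proj2 (HP v) _ (proj1 (HP w))) as H1.
  pose proof (proj2 (HP w) _ (proj1 (HP v))) as H2.
  pose proof (quadrilateral v w (P w) (P v)) as H3.
  rewrite (D_sym (P w) (P v)) in H2, H3. rewrite (D_sym (P v) v) in H3.
  pose proof (D_ge0 (P v) (P w)). pose proof (D_ge0 v w). nra.
Qed.

Lemma projection_dist_le (K : Y -> Prop) (P : Y -> Y) : is_projection K P ->
  forall v z, K z -> D v (P v) <= D v z.
Proof.
  intros HP v z Hz. apply le_of_sqr_le; [apply D_ge0|].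
  pose proof (proj2 (HP v) z Hz). pose proof (pow2_ge_0 (D (P v) z)). lra.
Qed.

Lemma projection_toward (K : Y -> Prop) (P : Y -> Y) : is_projection K P ->
  forall v z, K z -> D (P v) z <= D v z.
Proof.
  intros HP v z Hz. apply le_of_sqr_le; [apply D_ge0|].
  pose proof (proj2 (HP v) z Hz). pose proof (pow2_ge_0 (D v (P v))). lra.
Qed.

(* Although b need not lie in K, replacing a by its projection increases the
   distance to b only to second order in the distances to K. *)
Lemma projection_almost_toward (K : Y -> Prop) (P : Y -> Y) : is_projection K P ->
  forall a b, D b (P a) ^ 2 <= D a b ^ 2 + 2 * D a (P a) * D b (P b).
Proof.
  intros HP a b.
  pose proof (proj2 (HP a) _ (proj1 (HP b))) as H1.
  pose proof (quadrilateral b (P b) (P a) a) as H2.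
  rewrite (D_sym (P b) (P a)), (D_sym (P b) a), (D_sym (P a) a) in H2.
  pose proof (pow2_ge_0 (D a (P a))). lra.
Qed.

(** * Sweeping by a decreasing family of convex sets *)

Section Sweeping.

(** [Bd] is a region stable under the projections on which the sets move with speed at most C; it
    will be the unit ball of the cone. *)
Variables (K : R -> Y -> Prop) (P : R -> Y -> Y) (Bd : Y -> Prop) (T C : R).
Hypothesis T_ge0 : 0 <= T.
Hypothesis K_decr : forall s t v, 0 <= s -> s <= t -> t <= T -> K t v -> K s v.
Hypothesis K_proj : forall t, 0 <= t <= T -> is_projection (K t) (P t).
Hypothesis Bd_proj : forall t v, 0 <= t <= T -> Bd v -> Bd (P t v).
Hypothesis K_speed : forall s t v, 0 <= s -> s <= t -> t <= T ->
  K s v -> Bd v -> D v (P t v) <= C * (t - s).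

Fixpoint sweep (h : R) (n : nat) (v : Y) : Y :=
  match n with
  | O => v
  | S n => P (h * INR (S n)) (sweep h n v)
  end.

Lemma sweep_time (h : R) (n : nat) : 0 <= h -> h * INR (S n) <= T ->
  0 <= h * INR n /\ h * INR n <= h * INR (S n) /\ h * INR (S n) - h * INR n = h.
Proof. intros Hh. rewrite S_INR. pose proof (pos_INR n). nra. Qed.

Lemma sweep_inv (h : R) (n : nat) (v : Y) : 0 <= h -> h * INR n <= T ->
  K 0 v -> Bd v -> K (h * INR n) (sweep h n v) /\ Bd (sweep h n v).
Proof.
  intros Hh Hn Hv Hb. induction n as [|n IH].
  - simpl. rewrite Rmult_0_r. auto.
  - destruct (sweep_time h n Hh Hn) as [H1 [H2 H3]].
    destruct IH as [IH1 IH2]; [lra|]. cbn [sweep]. split.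
    + apply K_proj. lra.
    + apply Bd_proj; [lra|exact IH2].
Qed.

Lemma sweep_short (h : R) (n : nat) (v w : Y) : 0 <= h -> h * INR n <= T ->
  D (sweep h n v) (sweep h n w) <= D v w.
Proof.
  intros Hh Hn. induction n as [|n IH]; [simpl; lra|].
  destruct (sweep_time h n Hh Hn) as [H1 [H2 H3]]. cbn [sweep].
  apply Rle_trans with (2 := IH ltac:(lra)).
  apply projection_short with (K := K (h * INR (S n))). apply K_proj. lra.
Qed.

Lemma sweep_fix (h : R) (n : nat) (v : Y) : 0 <= h -> h * INR n <= T ->
  K T v -> D v (sweep h n v) = 0.
Proof.
  intros Hh Hn Hv. induction n as [|n IH]; [apply D_refl|].
  destruct (sweep_time h n Hh Hn) as [H1 [H2 H3]]. cbn [sweep].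
  specialize (IH ltac:(lra)).
  assert (HK : K (h * INR (S n)) v) by (apply K_decr with T; try lra; exact Hv).
  pose proof (projection_toward _ _ (K_proj (h * INR (S n)) ltac:(lra)) (sweep h n v) v HK) as H4.
  rewrite D_sym, (D_sym (sweep h n v)), IH in H4.
  apply Rle_antisym; [exact H4|apply D_ge0].
Qed.

(** It is the squared gap that grows by at most 2 (C h)^2 per coarse step, by
    [projection_almost_toward]. After T / h steps it is O(h), whatever the refinement factor k. *)
Lemma sweep_refine (h : R) (k n : nat) (v : Y) : 0 <= h -> h * INR n <= T ->
  (0 < k)%nat -> K 0 v -> Bd v ->
  D (sweep h n v) (sweep (h / INR k) (k * n) v) ^ 2 <= INR n * (2 * C ^ 2 * h ^ 2).
Proof.
  intros Hh Hn Hk Hv Hb.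
  assert (Hk0 : 0 < INR k) by (apply lt_0_INR; lia).
  assert (Hhk : 0 <= h / INR k) by (apply Rle_mult_inv_pos; lra).
  assert (Etime : forall i, h / INR k * INR (k * i) = h * INR i).
  { intros i. rewrite mult_INR. field. lra. }
  induction n as [|n IH].
  - rewrite Nat.mul_0_r. simpl. rewrite D_refl. lra.
  - destruct (sweep_time h n Hh Hn) as [H1 [H2 H3]].
    specialize (IH ltac:(lra)).
    set (a := sweep h n v) in *. set (b := sweep (h / INR k) (k * n) v) in *.
    destruct (sweep_inv h n v Hh ltac:(lra) Hv Hb) as [Ka Ba].
    assert (Hb2 : K (h * INR n) b /\ Bd b).
    { rewrite <- Etime. apply sweep_inv; auto. rewrite Etime. lra. }
    destruct Hb2 as [Kb Bb].
    cbn [sweep]. fold a. set (t := h * INR (S n)) in *.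
    assert (HPt := K_proj t ltac:(lra)).
    (* [P t a] lies in [K t], hence in the larger sets of all fine steps up to time t, so none of
       these steps moves away from it. *)
    assert (Hj : forall j, (j <= k)%nat ->
      D (sweep (h / INR k) (k * n + j) v) (P t a) <= D b (P t a)).
    { intros j. induction j as [|j IHj]; intros Hj.
      - rewrite Nat.add_0_r. right. reflexivity.
      - apply Rle_trans with (2 := IHj ltac:(lia)).
        rewrite Nat.add_succ_r. cbn [sweep].
        assert (Ht1 : h / INR k * INR (S (k * n + j)) <= t).
        { unfold t. rewrite <- (Etime (S n)). apply Rmult_le_compat_l; [exact Hhk|].
          apply le_INR. nia. }
        assert (Ht2 : 0 <= h / INR k * INR (S (k * n + j))).
        { apply Rmult_le_pos; [exact Hhk|apply pos_INR]. }
        apply projection_toward with (K := K (h / INR k * INR (S (k * n + j)))).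
        + apply K_proj. lra.
        + apply K_decr with t; try lra. apply HPt. }
    specialize (Hj k (Nat.le_refl _)).
    replace (k * n + k)%nat with (k * S n)%nat in Hj by lia.
    rewrite D_sym.
    pose proof (projection_almost_toward _ _ HPt a b) as H4.
    pose proof (K_speed (h * INR n) t a H1 H2 Hn Ka Ba) as Sa.
    pose proof (K_speed (h * INR n) t b H1 H2 Hn Kb Bb) as Sb.
    rewrite H3 in Sa, Sb.
    pose proof (D_ge0 a (P t a)). pose proof (D_ge0 b (P t b)).
    pose proof (D_ge0 (sweep (h / INR k) (k * S n) v) (P t a)).
    assert (Hp : D a (P t a) * D b (P t b) <= C * h * (C * h)) by (apply Rmult_le_compat; lra).
    assert (Hs : D (sweep (h / INR k) (k * S n) v) (P t a) ^ 2 <= D b (P t a) ^ 2)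
      by (apply pow_incr; split; lra).
    rewrite S_INR. nra.
Qed.

Definition sweep_seq (v : Y) (m : nat) : Y := sweep (T / 2 ^ m) (2 ^ m) v.

Lemma sweep_seq_time (m : nat) : 0 <= T / 2 ^ m /\ T / 2 ^ m * INR (2 ^ m) = T.
Proof.
  assert (H : 0 < 2 ^ m) by (apply pow_lt; lra). split.
  - apply Rle_mult_inv_pos; lra.
  - rewrite INR_pow2. field. lra.
Qed.

Lemma sweep_seq_cauchy (v : Y) : K 0 v -> Bd v -> cauchy_seq D (sweep_seq v).
Proof.
  intros Hv Hb.
  assert (Hclose : forall m j,
    D (sweep_seq v m) (sweep_seq v (m + j)) ^ 2 <= 2 * C ^ 2 * T ^ 2 * / 2 ^ m).
  { intros m j. destruct (sweep_seq_time m) as [H1 H2].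
    pose proof (sweep_refine (T / 2 ^ m) (2 ^ j) (2 ^ m) v H1 ltac:(lra)
      ltac:(apply Nat.neq_0_lt_0, Nat.pow_nonzero; lia) Hv Hb) as H.
    assert (P1 : 0 < 2 ^ m) by (apply pow_lt; lra).
    assert (P2 : 0 < 2 ^ j) by (apply pow_lt; lra).
    replace (T / 2 ^ m / INR (2 ^ j)) with (T / 2 ^ (m + j)) in H.
    2: { rewrite INR_pow2, pow_add. field. lra. }
    replace (2 ^ j * 2 ^ m)%nat with (2 ^ (m + j))%nat in H
      by (rewrite Nat.pow_add_r; lia).
    apply Rle_trans with (1 := H). right. rewrite INR_pow2. field. lra. }
  intros e He.
  destruct (inv_INR_small (2 * C ^ 2 * T ^ 2) ((e / 2) ^ 2)) as [N HN]; [nra|].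
  exists N.
  assert (Hfar : forall m, (N <= m)%nat -> D (sweep_seq v N) (sweep_seq v m) < e / 2).
  { intros m Hm. replace m with (N + (m - N))%nat by lia.
    specialize (Hclose N (m - N)%nat). specialize (HN N (Nat.le_refl _)).
    pose proof (inv_pow2_le N) as Hp.
    assert (0 <= 2 * C ^ 2 * T ^ 2) by (pose proof (pow2_ge_0 C); pose proof (pow2_ge_0 T); nra).
    assert (2 * C ^ 2 * T ^ 2 * / 2 ^ N <= 2 * C ^ 2 * T ^ 2 * / (INR N + 1))
      by (apply Rmult_le_compat_l; auto).
    pose proof (D_ge0 (sweep_seq v N) (sweep_seq v (N + (m - N)))). nra. }
  intros i j Hi Hj.
  pose proof (Hfar i Hi). pose proof (Hfar j Hj).
  pose proof (D_tri (sweep_seq v i) (sweep_seq v N) (sweep_seq v j)).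
  rewrite (D_sym (sweep_seq v i) (sweep_seq v N)) in *. lra.
Qed.

End Sweeping.

(** * Sweeping a cone onto a convex subcone *)

Section Cone.

Variables (ip : Y -> Y -> R) (scal : R -> Y -> Y) (U : Y -> Prop) (p : Y).
Hypothesis ip_sym : forall v w, ip v w = ip w v.
Hypothesis D_ip : forall v w, D v w ^ 2 = ip v v + ip w w - 2 * ip v w.
Hypothesis ip_scal : forall l v w, 0 <= l -> ip v (scal l w) = l * ip v w.
(** Concavity of [ip z] takes the place of linearity; it is the direction that makes 0 <= ip v p a
    convex condition on v. *)
Hypothesis ip_comb : forall t v w z, 0 <= t <= 1 ->
  (1 - t) * ip z v + t * ip z w <= ip z (comb t v w).
Hypothesis Y_complete : complete_set (fun _ => True).
Hypothesis U_convex : comb_convex U.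
Hypothesis U_scal : forall l v, 0 <= l -> U v -> U (scal l v).
Hypothesis U_p : U p.
Hypothesis p_norm : ip p p = 1.
Hypothesis U_ip_p : forall v, U v -> 0 <= ip v p.

Definition apex : Y := scal 0 p.

Lemma ip_scal_l (l : R) (v w : Y) : 0 <= l -> ip (scal l v) w = l * ip v w.
Proof. intros H. rewrite ip_sym, ip_scal, ip_sym by exact H. reflexivity. Qed.

Lemma ip_apex (v : Y) : ip v apex = 0.
Proof. unfold apex. rewrite ip_scal by lra. ring. Qed.

Lemma D_apex (v : Y) : D v apex ^ 2 = ip v v.
Proof. rewrite D_ip, !ip_apex. ring. Qed.

Lemma U_apex : U apex.
Proof. apply U_scal; [lra|exact U_p]. Qed.

Lemma D_apex_le1 (v : Y) : ip v v <= 1 -> D v apex <= 1.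
Proof. intros H. apply le_of_sqr_le; [lra|]. rewrite D_apex. lra. Qed.

Lemma D_p_apex : D apex p = 1.
Proof.
  assert (D apex p ^ 2 = 1) by (rewrite D_sym, D_apex; exact p_norm).
  pose proof (D_ge0 apex p). nra.
Qed.

(** There is no difference vector v - w to which Cauchy-Schwarz could be applied; Reshetnyak's
    inequality for v, w, [apex], p replaces it. *)
Lemma ip_p_lip (v w : Y) : ip v p <= ip w p + D v w.
Proof.
  pose proof (quadrilateral v w apex p) as H.
  rewrite !D_apex, D_p_apex, (D_ip w p), (D_ip p v), (ip_sym p v) in H. lra.
Qed.

Lemma ip_p_le1 (v : Y) : ip v v <= 1 -> ip v p <= 1.
Proof.
  intros H. pose proof (pow2_ge_0 (D v p)) as H1. rewrite D_ip, p_norm in H1. lra.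
Qed.

Lemma comb_norm_le1 (t : R) (v w : Y) : 0 <= t <= 1 -> ip v v <= 1 -> ip w w <= 1 ->
  ip (comb t v w) (comb t v w) <= 1.
Proof.
  intros Ht Hv Hw. pose proof (comb_npc t v w apex Ht) as H.
  rewrite (D_sym apex (comb t v w)), (D_sym apex v), (D_sym apex w), !D_apex in H.
  assert (0 <= t * (1 - t) * D v w ^ 2).
  { apply Rmult_le_pos; [nra|apply pow2_ge_0]. }
  nra.
Qed.

(** The ray through [P v] lies in K. Comparing [P v] with its multiples by 2 and by 0 gives the two
    opposite inequalities. *)
Lemma cone_projection_ip (K : Y -> Prop) (P : Y -> Y) : is_projection K P ->
  (forall l v, 0 <= l -> K v -> K (scal l v)) ->
  forall v, ip v (P v) = ip (P v) (P v).
Proof.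
  intros HP HK v. destruct (HP v) as [H1 H2].
  pose proof (H2 _ (HK 2 _ ltac:(lra) H1)) as H3.
  pose proof (H2 _ (HK 0 _ ltac:(lra) H1)) as H4.
  rewrite !D_ip, !ip_scal, !ip_scal_l in H3 by lra.
  rewrite !D_ip, !ip_scal, !ip_scal_l in H4 by lra. lra.
Qed.

Lemma cone_projection_norm (K : Y -> Prop) (P : Y -> Y) : is_projection K P ->
  (forall l v, 0 <= l -> K v -> K (scal l v)) ->
  forall v, ip (P v) (P v) = ip v v - D v (P v) ^ 2.
Proof.
  intros HP HK v. rewrite D_ip, (cone_projection_ip K P HP HK). ring.
Qed.

(** * The rotating wedges and their speed *)

Variable PU : Y -> Y.
Hypothesis PU_proj : is_projection U PU.

(* In the model case of a hemisphere inside a higher-dimensional one, wedge t is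
   a half-space rotating about the boundary of U, and sweeping rotates points into U. *)
Definition wedge (t : R) (v : Y) : Prop :=
  0 <= ip v p /\ Rmin 1 t * D v (PU v) <= Rmin 1 (2 - t) * ip v p.

Lemma Rmin1_range (t : R) : 0 <= t -> 0 <= Rmin 1 t <= 1.
Proof. intros H. unfold Rmin. destruct Rle_dec; lra. Qed.

Lemma PU_dist_le1 (v : Y) : ip v v <= 1 -> D v (PU v) <= 1.
Proof.
  intros H. apply Rle_trans with (D v apex).
  - apply projection_dist_le with U; [exact PU_proj|exact U_apex].
  - apply D_apex_le1. exact H.
Qed.

(** The Pythagorean inequality with z = p. Hence moving a point toward [PU v] does not spoil the
    right-hand side of the wedge condition. *)
Lemma PU_ip_p (v : Y) : ip v p <= ip (PU v) p.
Proof.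
  pose proof (proj2 (PU_proj v) p U_p) as H.
  pose proof (cone_projection_ip U PU PU_proj U_scal v) as E.
  rewrite !D_ip, E in H. lra.
Qed.

Lemma wedge_of_U (t : R) (v : Y) : 0 <= t <= 2 -> U v -> wedge t v.
Proof.
  intros Ht Hv. pose proof (U_ip_p v Hv). split; [assumption|].
  pose proof (projection_dist_le U PU PU_proj v v Hv) as H1. rewrite D_refl in H1.
  pose proof (Rmin1_range t ltac:(lra)). pose proof (Rmin1_range (2 - t) ltac:(lra)).
  pose proof (D_ge0 v (PU v)). nra.
Qed.

Lemma wedge_scal (t l : R) (v : Y) : 0 <= t <= 2 -> 0 <= l -> wedge t v -> wedge t (scal l v).
Proof.
  intros Ht Hl [H1 H2]. unfold wedge. rewrite ip_scal_l by exact Hl.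
  split; [nra|].
  assert (H3 : D (scal l v) (PU (scal l v)) <= l * D v (PU v)).
  { apply Rle_trans with (D (scal l v) (scal l (PU v))).
    - apply projection_dist_le with U; [exact PU_proj|].
      apply U_scal; [exact Hl|apply PU_proj].
    - apply le_of_sqr_le; [apply Rmult_le_pos; [exact Hl|apply D_ge0]|].
      rewrite Rpow_mult_distr, !D_ip, !ip_scal, !ip_scal_l by exact Hl. right. ring. }
  pose proof (Rmin1_range t ltac:(lra)).
  apply Rle_trans with (l * (Rmin 1 t * D v (PU v))); nra.
Qed.

Lemma wedge_decr (s t : R) (v : Y) : 0 <= s -> s <= t -> t <= 2 -> wedge t v -> wedge s v.
Proof.
  intros Hs Hst Ht [H1 H2]. split; [exact H1|].
  assert (Rmin 1 s <= Rmin 1 t) by (apply Rle_min_compat_l; exact Hst).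
  assert (Rmin 1 (2 - t) <= Rmin 1 (2 - s)) by (apply Rle_min_compat_l; lra).
  pose proof (D_ge0 v (PU v)). nra.
Qed.

Lemma PU_comb_dist (t : R) (v w : Y) : 0 <= t <= 1 ->
  D (comb t v w) (PU (comb t v w)) <= (1 - t) * D v (PU v) + t * D w (PU w).
Proof.
  intros Ht. apply Rle_trans with (2 := comb_dist t v (PU v) w (PU w) Ht).
  apply projection_dist_le with U; [exact PU_proj|].
  apply U_convex; [exact Ht|apply PU_proj|apply PU_proj].
Qed.

Lemma ip_p_comb (t : R) (v w : Y) : 0 <= t <= 1 ->
  (1 - t) * ip v p + t * ip w p <= ip (comb t v w) p.
Proof.
  intros Ht. rewrite (ip_sym v), (ip_sym w), (ip_sym (comb t v w)). apply ip_comb. exact Ht.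
Qed.

(** In v, the distance to U is convex and [ip v p] is concave, and both coefficients are
    nonnegative. *)
Lemma wedge_convex (t : R) : 0 <= t <= 2 -> comb_convex (wedge t).
Proof.
  intros Ht l v w Hl [V1 V2] [W1 W2].
  pose proof (ip_p_comb l v w Hl) as H1. pose proof (PU_comb_dist l v w Hl) as H2.
  pose proof (Rmin1_range t ltac:(lra)) as Ra. pose proof (Rmin1_range (2 - t) ltac:(lra)) as Rb.
  split; [nra|].
  apply Rle_trans with (Rmin 1 t * ((1 - l) * D v (PU v) + l * D w (PU w))).
  - apply Rmult_le_compat_l; lra.
  - apply Rle_trans with (Rmin 1 (2 - t) * ((1 - l) * ip v p + l * ip w p)).
    + nra.
    + apply Rmult_le_compat_l; lra.
Qed.

Lemma wedge_complete (t : R) : 0 <= t <= 2 -> complete_set (wedge t).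
Proof.
  intros Ht u Hu Hc. destruct (Y_complete u (fun _ => I) Hc) as [l [_ Hl]].
  exists l. split; [|exact Hl].
  pose proof (Rmin1_range t ltac:(lra)) as Ra. pose proof (Rmin1_range (2 - t) ltac:(lra)) as Rb.
  split.
  - apply Rle_of_eps with (c := 1). intros e He. destruct (Hl e He) as [N HN].
    specialize (HN N (Nat.le_refl _)). destruct (Hu N) as [H1 _].
    pose proof (ip_p_lip (u N) l). lra.
  - apply Rle_of_eps with (c := 2). intros e He. destruct (Hl e He) as [N HN].
    specialize (HN N (Nat.le_refl _)). destruct (Hu N) as [H1 H2].
    pose proof (ip_p_lip (u N) l) as H3.
    assert (H4 : D l (PU l) <= D (u N) l + D (u N) (PU (u N))).
    { apply Rle_trans with (D l (PU (u N))).
      - apply projection_dist_le with U; [exact PU_proj|apply PU_proj].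
      - rewrite (D_sym (u N) l). apply D_tri. }
    pose proof (D_ge0 (u N) l).
    apply Rle_trans with (Rmin 1 t * (D (u N) l + D (u N) (PU (u N)))).
    + apply Rmult_le_compat_l; lra.
    + nra.
Qed.

(** Move v toward p by the ratio t - s. The product with p gains t - s, which pays for raising the
    coefficient from s to t because D v (PU v) <= 1. The factor 2 bounds D v p through the apex, and
    the norm bound on z lets the second phase start from it. *)
Lemma wedge_speed_tilt (s t : R) (v : Y) : 0 <= s -> s <= t -> t <= 1 ->
  wedge s v -> ip v v <= 1 ->
  exists z, wedge t z /\ ip z z <= 1 /\ D v z <= 2 * (t - s).
Proof.
  intros Hs Hst Ht [H1 H2] Hv.
  rewrite Rmin_right, Rmin_left in H2 by lra.
  assert (Hh : 0 <= t - s <= 1) by lra.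
  pose proof (PU_comb_dist (t - s) v p Hh) as H3.
  pose proof (ip_p_comb (t - s) v p Hh) as H4.
  pose proof (projection_dist_le U PU PU_proj p p U_p) as H5. rewrite D_refl in H5.
  pose proof (PU_dist_le1 v Hv) as H6. pose proof (D_ge0 v (PU v)) as H7.
  rewrite p_norm in H4.
  exists (comb (t - s) v p). split; [|split].
  - split; [nra|]. rewrite Rmin_right, Rmin_left by lra.
    assert (H8 : D (comb (t - s) v p) (PU (comb (t - s) v p)) <= (1 - (t - s)) * D v (PU v)).
    { assert ((t - s) * D p (PU p) <= 0) by nra. lra. }
    apply Rle_trans with (t * ((1 - (t - s)) * D v (PU v))); [nra|].
    assert (E : t * ((1 - (t - s)) * D v (PU v))
      = (1 - (t - s)) * (s * D v (PU v)) + (1 - (t - s)) * (t - s) * D v (PU v)) by ring.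
    assert ((1 - (t - s)) * (t - s) * D v (PU v) <= t - s).
    { assert (0 <= (1 - (t - s)) * (t - s) <= t - s) by nra. nra. }
    assert ((1 - (t - s)) * (s * D v (PU v)) <= (1 - (t - s)) * ip v p) by nra.
    lra.
  - apply comb_norm_le1; [exact Hh|exact Hv|lra].
  - apply Rle_trans with (1 := comb_dist_l _ v p Hh).
    pose proof (D_tri v apex p). rewrite D_p_apex in *. pose proof (D_apex_le1 v Hv). nra.
Qed.

(** Move v toward [PU v]: the distance to U shrinks by the factor 1 - l, while the product with p
    does not decrease. *)
Lemma wedge_speed_close (s t : R) (v : Y) : 1 <= s -> s <= t -> t <= 2 ->
  wedge s v -> ip v v <= 1 -> exists z, wedge t z /\ D v z <= 2 * (t - s).
Proof.
  intros Hs Hst Ht [H1 H2] Hv.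
  rewrite Rmin_left, Rmin_right in H2 by lra. rewrite Rmult_1_l in H2.
  (* The ratio below has denominator 2 - s; for s = 2 also t = 2, and v itself serves. *)
  destruct (Req_dec s 2) as [->|Hs2].
  { exists v. rewrite D_refl. split; [|lra]. replace t with 2 by lra.
    split; [exact H1|]. rewrite Rmin_left, Rmin_right by lra. lra. }
  (* Chosen so that (1 - l) (2 - s) = 2 - t, exactly the coefficient required at time t. *)
  set (l := (t - s) / (2 - s)).
  assert (El : l * (2 - s) = t - s) by (unfold l; field; lra).
  assert (Hl : 0 <= l <= 1).
  { split; [apply Rle_mult_inv_pos; lra|]. apply Rmult_le_reg_r with (2 - s); lra. }
  assert (E1 : (1 - l) * (2 - s) = 2 - t) by lra.
  pose proof (ip_p_comb l v (PU v) Hl) as H4. pose proof (PU_ip_p v) as H5.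
  assert (H6 : ip v p <= ip (comb l v (PU v)) p) by nra.
  pose proof (ip_p_le1 v Hv) as H7.
  exists (comb l v (PU v)). split; [split|].
  - lra.
  - rewrite Rmin_left, Rmin_right, Rmult_1_l by lra.
    apply Rle_trans with (D (comb l v (PU v)) (PU v)).
    { apply projection_dist_le with U; [exact PU_proj|apply PU_proj]. }
    apply Rle_trans with (1 := comb_dist_r l v (PU v) Hl).
    apply Rle_trans with ((1 - l) * ((2 - s) * ip v p)); [apply Rmult_le_compat_l; lra|].
    rewrite <- Rmult_assoc, E1. apply Rmult_le_compat_l; lra.
  - apply Rle_trans with (1 := comb_dist_l l v (PU v) Hl).
    apply Rle_trans with (l * ((2 - s) * ip v p)); [apply Rmult_le_compat_l; lra|].
    rewrite <- Rmult_assoc, El. nra.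
Qed.

Lemma wedge_speed (s t : R) (v : Y) : 0 <= s -> s <= t -> t <= 2 ->
  wedge s v -> ip v v <= 1 -> exists z, wedge t z /\ D v z <= 2 * (t - s).
Proof.
  intros Hs Hst Ht Hv Hb.
  destruct (Rle_or_lt 1 s) as [H1|H1]; [apply wedge_speed_close; auto|].
  destruct (Rle_or_lt t 1) as [H2|H2].
  - destruct (wedge_speed_tilt s t v) as [z [Hz1 [_ Hz2]]]; auto. exists z. auto.
  - destruct (wedge_speed_tilt s 1 v) as [z [Hz1 [Hz2 Hz3]]]; try lra; auto.
    destruct (wedge_speed_close 1 t z) as [z' [Hz1' Hz2']]; try lra; auto.
    exists z'. split; [exact Hz1'|]. pose proof (D_tri v z z'). lra.
Qed.

Theorem cone_retraction : exists F : Y -> Y,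
  (forall v, 0 <= ip v p -> ip v v = 1 -> U (F v) /\ ip (F v) (F v) = 1) /\
  (forall v w, 0 <= ip v p -> ip v v = 1 -> 0 <= ip w p -> ip w w = 1 ->
     D (F v) (F w) <= D v w) /\
  (forall v, U v -> ip v v = 1 -> D v (F v) = 0).
Proof.
  assert (HP : forall t, exists P, 0 <= t <= 2 -> is_projection (wedge t) P).
  { intros t. destruct (Rle_or_lt 0 t) as [H1|H1]; [|exists (fun v => v); lra].
    destruct (Rle_or_lt t 2) as [H2|H2]; [|exists (fun v => v); lra].
    destruct (projection_exists (wedge t)) as [P HP].
    - exists p. apply wedge_of_U; auto.
    - apply wedge_convex. lra.
    - apply wedge_complete. lra.
    - exists P. auto. }
  set (P := fun t => proj1_sig (constructive_indefinite_description _ (HP t))).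
  assert (P_proj : forall t, 0 <= t <= 2 -> is_projection (wedge t) (P t)).
  { intros t. unfold P. destruct (constructive_indefinite_description _ (HP t)). auto. }
  assert (P_norm : forall t v, 0 <= t <= 2 ->
    ip (P t v) (P t v) = ip v v - D v (P t v) ^ 2).
  { intros t v Ht. apply cone_projection_norm with (wedge t); [auto|].
    intros l u Hl Hu. apply wedge_scal; auto. }
  set (Bd := fun v => ip v v <= 1).
  assert (P_Bd : forall t v, 0 <= t <= 2 -> Bd v -> Bd (P t v)).
  { intros t v Ht Hv. unfold Bd. rewrite P_norm by exact Ht.
    pose proof (pow2_ge_0 (D v (P t v))). unfold Bd in Hv. lra. }
  assert (P_speed : forall s t v, 0 <= s -> s <= t -> t <= 2 ->
    wedge s v -> Bd v -> D v (P t v) <= 2 * (t - s)).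
  { intros s t v Hs Hst Ht Hv Hb. destruct (wedge_speed s t v) as [z [Hz1 Hz2]]; auto.
    apply Rle_trans with (2 := Hz2). apply projection_dist_le with (wedge t); auto.
    apply P_proj. lra. }
  set (sq := sweep_seq P 2).
  assert (H02 : 0 <= 2) by lra.
  assert (W0 : forall v, 0 <= ip v p -> wedge 0 v).
  { intros v Hv. split; [exact Hv|]. rewrite Rmin_right, Rmin_left by lra. lra. }
  assert (sq_inv : forall v m, 0 <= ip v p -> Bd v -> wedge 2 (sq v m) /\ Bd (sq v m)).
  { intros v m Hv Hb. destruct (sweep_seq_time 2 H02 m) as [T1 T2].
    pose proof (sweep_inv wedge P Bd 2 P_proj P_Bd (2 / 2 ^ m) (2 ^ m) v T1
      ltac:(lra) (W0 v Hv) Hb) as H.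
    rewrite T2 in H. exact H. }
  (* Each of the 2^m steps has length at most 4 / 2^m and costs its square, 16 / 4^m; the total is
     16 / 2^m. *)
  assert (sq_norm : forall v m, 0 <= ip v p -> ip v v = 1 ->
    1 - 16 * / 2 ^ m <= ip (sq v m) (sq v m)).
  { intros v m Hv Hn. destruct (sweep_seq_time 2 H02 m) as [T1 T2].
    assert (Hb : Bd v) by (unfold Bd; lra).
    assert (Hstep : forall n, 2 / 2 ^ m * INR n <= 2 ->
      1 - INR n * (2 * (2 / 2 ^ m)) ^ 2
        <= ip (sweep P (2 / 2 ^ m) n v) (sweep P (2 / 2 ^ m) n v)).
    { induction n as [|n IH]; intros Hle; [simpl; lra|].
      destruct (sweep_time 2 (2 / 2 ^ m) n T1 Hle) as [E1 [E2 E3]].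
      specialize (IH ltac:(lra)).
      destruct (sweep_inv wedge P Bd 2 P_proj P_Bd (2 / 2 ^ m) n v T1
        ltac:(lra) (W0 v Hv) Hb) as [Wn Bn].
      cbn [sweep]. rewrite P_norm by lra.
      pose proof (P_speed _ _ _ E1 E2 Hle Wn Bn) as Sn. rewrite E3 in Sn.
      set (a := sweep P (2 / 2 ^ m) n v) in *.
      assert (D a (P (2 / 2 ^ m * INR (S n)) a) ^ 2 <= (2 * (2 / 2 ^ m)) ^ 2).
      { apply pow_incr. split; [apply D_ge0|exact Sn]. }
      rewrite S_INR in *. lra. }
    specialize (Hstep (2 ^ m)%nat ltac:(lra)). unfold sq, sweep_seq.
    apply Rle_trans with (2 := Hstep). right. rewrite INR_pow2. field.
    apply pow_nonzero. lra. }
  assert (HF : forall v, exists l, 0 <= ip v p -> ip v v = 1 ->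
    U l /\ ip l l = 1 /\ converges_to D (sq v) l).
  { intros v. destruct (classic (0 <= ip v p /\ ip v v = 1)) as [[Hv Hn]|Hno].
    2: { exists v. tauto. }
    assert (Hb : Bd v) by (unfold Bd; lra).
    destruct (wedge_complete 2 ltac:(lra) (sq v)) as [l [Wl Hl]].
    - intros m. apply sq_inv; auto.
    - apply (sweep_seq_cauchy wedge P Bd 2 2 H02 wedge_decr P_proj P_Bd P_speed v); auto.
    - exists (PU l). intros _ _.
      assert (Dl : D l (PU l) = 0).
      { destruct Wl as [W1 W2]. rewrite Rmin_left, Rmin_right in W2 by lra.
        pose proof (D_ge0 l (PU l)). lra. }
      assert (Hc : converges_to D (sq v) (PU l)).
      { intros e He. destruct (Hl e He) as [N HN]. exists N. intros n Hn'.
        specialize (HN n Hn'). pose proof (D_tri (sq v n) l (PU l)). lra. }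
      split; [apply PU_proj|]. split; [|exact Hc].
      assert (Hle : D (PU l) apex <= 1).
      { apply Rle_of_eps with (c := 1). intros e He. destruct (Hc e He) as [N HN].
        specialize (HN N (Nat.le_refl _)). pose proof (D_tri (PU l) (sq v N) apex).
        rewrite (D_sym (PU l) (sq v N)) in *.
        pose proof (D_apex_le1 _ (proj2 (sq_inv v N Hv Hb))). lra. }
      assert (Hge : 1 <= D (PU l) apex).
      { apply Rle_of_eps with (c := 2). intros e He. destruct (Hc e He) as [N HN].
        destruct (inv_INR_small 16 e He) as [N2 HN2].
        set (m := max N N2). specialize (HN m (Nat.le_max_l _ _)).
        specialize (HN2 m (Nat.le_max_r _ _)).
        pose proof (D_tri (sq v m) (PU l) apex).
        pose proof (D_apex_le1 _ (proj2 (sq_inv v m Hv Hb))) as H1.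
        pose proof (sq_norm v m Hv Hn) as H2. rewrite <- D_apex in H2.
        pose proof (D_ge0 (sq v m) apex).
        pose proof (inv_pow2_le m). nra. }
      rewrite <- D_apex. replace (D (PU l) apex) with 1 by lra. ring. }
  exists (fun v => proj1_sig (constructive_indefinite_description _ (HF v))).
  split; [|split].
  - intros v Hv Hn. destruct (constructive_indefinite_description _ (HF v)) as [l Hl]. simpl.
    destruct (Hl Hv Hn) as [H1 [H2 _]]. auto.
  - intros v w Hv Hvn Hw Hwn.
    destruct (constructive_indefinite_description _ (HF v)) as [l Hl].
    destruct (constructive_indefinite_description _ (HF w)) as [l' Hl']. simpl.
    destruct (Hl Hv Hvn) as [_ [_ H1]]. destruct (Hl' Hw Hwn) as [_ [_ H2]].
    apply Rle_of_eps with (c := 2). intros e He.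
    destruct (H1 e He) as [N HN]. destruct (H2 e He) as [N' HN'].
    set (m := max N N'). specialize (HN m (Nat.le_max_l _ _)).
    specialize (HN' m (Nat.le_max_r _ _)).
    pose proof (D_tri l (sq v m) l'). pose proof (D_tri (sq v m) (sq w m) l').
    rewrite (D_sym l (sq v m)) in *.
    destruct (sweep_seq_time 2 H02 m) as [T1 T2].
    pose proof (sweep_short wedge P 2 H02 P_proj (2 / 2 ^ m) (2 ^ m) v w T1 ltac:(lra)) as Hs.
    fold (sweep_seq P 2 v m) in Hs. fold (sweep_seq P 2 w m) in Hs. fold sq in Hs. lra.
  - intros v Hv Hn. destruct (constructive_indefinite_description _ (HF v)) as [l Hl]. simpl.
    destruct (Hl (U_ip_p v Hv) Hn) as [_ [_ H1]].
    apply Rle_antisym; [|apply D_ge0].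
    apply Rle_of_eps with (c := 1). intros e He. destruct (H1 e He) as [N HN].
    specialize (HN N (Nat.le_refl _)).
    destruct (sweep_seq_time 2 H02 N) as [T1 T2].
    pose proof (sweep_fix wedge P 2 wedge_decr P_proj (2 / 2 ^ N) (2 ^ N) v T1 ltac:(lra)
      (wedge_of_U 2 v ltac:(lra) Hv)) as Hs.
    fold (sweep_seq P 2 v N) in Hs. fold sq in Hs.
    pose proof (D_tri v (sq v N) l). lra.
Qed.

End Cone.

End NPC.

(** * Limits along an ultrafilter *)

Lemma nonprincipal_ultrafilter_exists : exists w, ultrafilter w /\ nonprincipal w.
Proof.
  destruct (@filter.ultraFilterLemma _ filter.eventually filter.eventually_filter)
    as [G [HG HE]].
  pose proof (@filter.ultra_proper _ _ HG) as HP.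
  pose proof (@filter.filter_filter _ _ HP) as HF.
  assert (Hempty : ~ G (fun _ => False)) by exact (@filter.filter_not_empty _ _ HP).
  assert (Hinter : forall A B : nat -> Prop, G A -> G B -> G (fun n => A n /\ B n)).
  { intros A B HA HB. exact (@filter.filterI _ _ HF A B HA HB). }
  assert (Hmono : forall A B : nat -> Prop, (forall n, A n -> B n) -> G A -> G B).
  { intros A B HAB HA. exact (@filter.filterS _ _ HF A B HAB HA). }
  exists G. split.
  - repeat split; auto.
    + exact (@filter.filterT _ _ HF).
    + intros A. exact (@filter.in_ultra_setVsetC _ G A HG).
  - intros k Hk. apply Hempty.
    assert (Hne : G (fun n => n <> k)).
    { apply HE. exists (S k); [exact I|]. intros n Hn.
      apply (ssrbool.elimT ssrnat.leP) in Hn. lia. }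
    apply Hmono with (2 := Hinter _ _ Hk Hne). intros n [H1 H2]. auto.
Qed.

Section UltraLimit.

Variable w : (nat -> Prop) -> Prop.
Hypothesis w_ultra : ultrafilter w.

Lemma w_mono (A B : nat -> Prop) : w A -> (forall n, A n -> B n) -> w B.
Proof. intros H1 H2. destruct w_ultra as [_ [_ [H _]]]. apply (H A B); auto. Qed.

Lemma w_and (A B : nat -> Prop) : w A -> w B -> w (fun n => A n /\ B n).
Proof. apply w_ultra. Qed.

Lemma w_all (A : nat -> Prop) : (forall n, A n) -> w A.
Proof. intros H. apply w_mono with (fun _ => True); [apply w_ultra|auto]. Qed.

Lemma w_ex (A : nat -> Prop) : w A -> exists n, A n.
Proof.
  intros H. apply NNPP. intros Hn. apply (proj1 (proj2 w_ultra)).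
  apply w_mono with (1 := H). intros n Hn'. apply Hn. exists n. exact Hn'.
Qed.

Lemma w_not (A : nat -> Prop) : ~ w A -> w (fun n => ~ A n).
Proof. intros H. destruct (proj2 (proj2 (proj2 (proj2 w_ultra))) A); tauto. Qed.

Lemma w_forall_lt (A : nat -> nat -> Prop) (m : nat) :
  (forall i, (i < m)%nat -> w (A i)) -> w (fun n => forall i, (i < m)%nat -> A i n).
Proof.
  induction m as [|m IH]; intros H.
  - apply w_all. intros n i Hi. lia.
  - apply w_mono with (fun n => (forall i, (i < m)%nat -> A i n) /\ A m n).
    + apply w_and; [apply IH; intros; apply H; lia|apply H; lia].
    + intros n [H1 H2] i Hi. destruct (Nat.eq_dec i m) as [->|]; [exact H2|apply H1; lia].
Qed.

Lemma w_ge (m : nat) : nonprincipal w -> w (fun n => (m <= n)%nat).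
Proof.
  intros Hnp. apply w_mono with (fun n => forall i, (i < m)%nat -> n <> i).
  - apply w_forall_lt. intros i _. apply w_not, Hnp.
  - intros n H. destruct (Nat.le_gt_cases m n) as [|Hlt]; [assumption|].
    exfalso. exact (H n Hlt eq_refl).
Qed.

(** The limit is the supremum of the levels r such that r <= a n for w-almost every n. *)
Lemma ulim_exists (a : nat -> R) (B : R) : (forall n, Rabs (a n) <= B) ->
  exists L, ulim w a L.
Proof.
  intros HB.
  assert (HB' : forall n, - B <= a n <= B).
  { intros n. specialize (HB n). unfold Rabs in HB. destruct Rcase_abs; lra. }
  destruct (completeness (fun r => w (fun n => r <= a n))) as [L [HL1 HL2]].
  - exists B. intros r Hr. destruct (w_ex _ Hr) as [n Hn]. specialize (HB' n). lra.
  - exists (- B). apply w_all. intros n. apply HB'.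
  - exists L. intros e He.
    assert (H1 : w (fun n => L - e < a n)).
    { apply NNPP. intros Hn. assert (L <= L - e); [|lra].
      apply HL2. intros r Hr. destruct (Rle_or_lt r (L - e)) as [|Hlt]; [assumption|].
      exfalso. apply Hn. apply w_mono with (1 := Hr). intros; lra. }
    assert (H2 : w (fun n => ~ (L + e <= a n))).
    { apply w_not. intros Hw. specialize (HL1 _ Hw). lra. }
    apply w_mono with (1 := w_and _ _ H1 H2). intros n [Ha Hb].
    apply Rabs_def1; lra.
Qed.

Lemma ulim_le (a b : nat -> R) (La Lb : R) : ulim w a La -> ulim w b Lb ->
  w (fun n => a n <= b n) -> La <= Lb.
Proof.
  intros Ha Hb Hle. apply Rle_of_eps with (c := 2). intros e He.
  destruct (w_ex _ (w_and _ _ Hle (w_and _ _ (Ha e He) (Hb e He)))) as [n [H1 [H2 H3]]].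
  apply Rabs_def2 in H2. apply Rabs_def2 in H3. lra.
Qed.

Lemma ulim_unique (a : nat -> R) (L L' : R) : ulim w a L -> ulim w a L' -> L = L'.
Proof.
  intros H H'. apply Rle_antisym; eapply ulim_le; eauto; apply w_all; intros; lra.
Qed.

Lemma ulim_const (c : R) : ulim w (fun _ => c) c.
Proof. intros e He. apply w_all. intros _. rewrite Rminus_diag, Rabs_R0. exact He. Qed.

Lemma ulim_ext (a b : nat -> R) (L : R) : (forall n, a n = b n) -> ulim w a L -> ulim w b L.
Proof.
  intros Hab H e He. apply w_mono with (1 := H e He). intros n. rewrite Hab. auto.
Qed.

Lemma ulim_comp (f : R -> R) (a : nat -> R) (L : R) : continuity_pt f L ->
  ulim w a L -> ulim w (fun n => f (a n)) (f L).
Proof.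
  intros Hf Ha e He. destruct (Hf e He) as [dl [Hdl H]].
  apply w_mono with (1 := Ha dl Hdl). intros n Hn.
  (* [continuity_pt] speaks only of arguments different from L. *)
  destruct (Req_dec L (a n)) as [<-|Hne].
  - rewrite Rminus_diag, Rabs_R0. exact He.
  - apply (H (a n)). split; [split; [exact I|exact Hne]|exact Hn].
Qed.

Lemma ulim_plus (a b : nat -> R) (La Lb : R) : ulim w a La -> ulim w b Lb ->
  ulim w (fun n => a n + b n) (La + Lb).
Proof.
  intros Ha Hb e He.
  apply w_mono with (1 := w_and _ _ (Ha (e / 2) ltac:(lra)) (Hb (e / 2) ltac:(lra))).
  intros n [H1 H2]. apply Rabs_def2 in H1. apply Rabs_def2 in H2. apply Rabs_def1; lra.
Qed.

Lemma ulim_scal (c : R) (a : nat -> R) (L : R) : ulim w a L ->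
  ulim w (fun n => c * a n) (c * L).
Proof. intros H. apply (ulim_comp (fun x => c * x)); [|exact H]. reg. Qed.

End UltraLimit.

(** * Triangle comparison along geodesics *)

Lemma cos_sum_avg (a b : R) : cos a + cos b = 2 * cos ((a + b) / 2) * cos ((a - b) / 2).
Proof.
  assert (Ea : a = (a + b) / 2 + (a - b) / 2) by field.
  assert (Eb : b = (a + b) / 2 - (a - b) / 2) by field.
  set (s := (a + b) / 2) in *. set (t := (a - b) / 2) in *.
  rewrite Ea, Eb, cos_plus, cos_minus. ring.
Qed.

Lemma cos_diff_avg (a b : R) : cos a - cos b = - 2 * sin ((a + b) / 2) * sin ((a - b) / 2).
Proof.
  assert (Ea : a = (a + b) / 2 + (a - b) / 2) by field.
  assert (Eb : b = (a + b) / 2 - (a - b) / 2) by field.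
  set (s := (a + b) / 2) in *. set (t := (a - b) / 2) in *.
  rewrite Ea, Eb, cos_plus, cos_minus. ring.
Qed.

Lemma cos_sq_le_of_range (e x : R) : 0 <= e <= PI / 2 -> e <= x <= PI - e ->
  cos x ^ 2 <= cos e ^ 2.
Proof.
  intros He Hx. pose proof PI_RGT_0.
  assert (H1 : cos x <= cos e) by (apply cos_decr_1; lra).
  assert (H2 : - cos e <= cos x).
  { replace (- cos e) with (cos (PI - e)).
    - apply cos_decr_1; lra.
    - rewrite cos_minus, cos_PI, sin_PI. ring. }
  pose proof (cos_ge_0 e). nra.
Qed.

Lemma cos_sq_ge_of_range (e x : R) : 0 <= e <= PI / 2 -> - e <= x <= e ->
  cos e ^ 2 <= cos x ^ 2.
Proof.
  intros He Hx. pose proof PI_RGT_0.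
  assert (H0 : 0 <= cos e) by (apply cos_ge_0; lra).
  assert (H1 : cos e <= cos x).
  { destruct (Rle_or_lt 0 x).
    - apply cos_decr_1; lra.
    - rewrite <- (cos_neg x). apply cos_decr_1; lra. }
  nra.
Qed.

(* The squared terms are the first two coordinates of the apex of a spherical triangle
   with sides al, be, 2e whose base is centred at (1,0,0) along the second axis. *)
Lemma apex_in_unit_disc (al be e : R) : 0 < e < PI / 2 ->
  - 2 * e <= al - be <= 2 * e -> 2 * e <= al + be <= 2 * PI - 2 * e ->
  ((cos al + cos be) / (2 * cos e)) ^ 2 + ((cos al - cos be) / (2 * sin e)) ^ 2 <= 1.
Proof.
  intros He Hd Hs. pose proof PI_RGT_0.
  rewrite cos_sum_avg, cos_diff_avg.
  set (sg := (al + be) / 2). set (ta := (al - be) / 2).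
  assert (H1 : cos sg ^ 2 <= cos e ^ 2) by (apply cos_sq_le_of_range; unfold sg; lra).
  assert (H2 : cos e ^ 2 <= cos ta ^ 2) by (apply cos_sq_ge_of_range; unfold ta; lra).
  assert (Hc : 0 < cos e) by (apply cos_gt_0; lra).
  assert (Hsn : 0 < sin e) by (apply sin_gt_0; lra).
  assert (Es : sin sg ^ 2 = 1 - cos sg ^ 2) by (pose proof (sin2_cos2 sg); unfold Rsqr in *; nra).
  assert (Et : sin ta ^ 2 = 1 - cos ta ^ 2) by (pose proof (sin2_cos2 ta); unfold Rsqr in *; nra).
  assert (Ee : sin e ^ 2 = 1 - cos e ^ 2) by (pose proof (sin2_cos2 e); unfold Rsqr in *; nra).
  replace ((2 * cos sg * cos ta / (2 * cos e)) ^ 2)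
    with (cos sg ^ 2 * cos ta ^ 2 / cos e ^ 2) by (field; lra).
  replace ((- 2 * sin sg * sin ta / (2 * sin e)) ^ 2)
    with (sin sg ^ 2 * sin ta ^ 2 / sin e ^ 2) by (field; lra).
  rewrite Es, Et.
  assert (Ht1 : cos ta ^ 2 <= 1) by (pose proof (pow2_ge_0 (sin ta)); lra).
  assert (Hc2 : 0 < cos e ^ 2) by (apply pow_lt; lra).
  assert (Hs2 : 0 < sin e ^ 2) by (apply pow_lt; lra).
  rewrite Ee in *.
  set (c := cos sg ^ 2) in *. set (x := cos ta ^ 2) in *. set (k := cos e ^ 2) in *.
  (* The defect factors, and its sign is read off from c <= k <= x. *)
  assert (E : 1 - (c * x / k + (1 - c) * (1 - x) / (1 - k))
    = (x - k) * (k - c) / (k * (1 - k))) by (field; lra).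
  assert (0 <= (x - k) * (k - c) / (k * (1 - k))).
  { apply Rle_mult_inv_pos; nra. }
  lra.
Qed.

Section CAT1Cone.

Variables (X : Type) (d : X -> X -> R).
Hypothesis d_met : is_metric d.
Hypothesis d_cat : CAT1 d.
Hypothesis d_le_PI : forall x y, d x y <= PI.

Lemma d_ge0 (x y : X) : 0 <= d x y.
Proof. apply d_met. Qed.

Lemma d_sym (x y : X) : d x y = d y x.
Proof. apply d_met. Qed.

Lemma d_tri (x y z : X) : d x z <= d x y + d y z.
Proof. apply d_met. Qed.

Lemma d_refl (x : X) : d x x = 0.
Proof. apply d_met. reflexivity. Qed.

(** The comparison triangle is written in coordinates, with [u3] and [v3] symmetric about [m3] and
    A, B solving the cosine equations for the two sides at z. Then A is the cosine of the median,
    and CAT(1) bounds the true median by it. *)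
Lemma midpoint_comparison (u v z : X) (g : R -> X) : geodesic d u v g ->
  0 < d u v -> d v z < PI -> d z u < PI ->
  d u v + d v z + d z u < 2 * PI ->
  cos (d z u) + cos (d z v) <= 2 * cos (d u v / 2) * cos (d z (g (d u v / 2))).
Proof.
  intros Hg Huv Hvz Hzu Hper.
  set (e := d u v / 2). set (al := d z u). set (be := d z v).
  pose proof PI_RGT_0.
  assert (He : 0 < e < PI / 2).
  { pose proof (d_tri u z v). rewrite (d_sym u z), (d_sym z v) in *. unfold e. lra. }
  assert (Hal : 0 <= al <= PI) by (split; [apply d_ge0|unfold al; lra]).
  assert (Hbe : 0 <= be <= PI) by (split; [apply d_ge0|unfold be; rewrite d_sym; lra]).
  assert (HA : ((cos al + cos be) / (2 * cos e)) ^ 2 + ((cos al - cos be) / (2 * sin e)) ^ 2 <= 1).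
  { apply apex_in_unit_disc; [exact He| |]; unfold al, be, e.
    - pose proof (d_tri z v u). pose proof (d_tri z u v). rewrite (d_sym v u) in *. lra.
    - pose proof (d_tri u z v). rewrite (d_sym u z) in *. rewrite (d_sym v z) in *. lra. }
  set (A := (cos al + cos be) / (2 * cos e)) in *.
  set (B := (cos al - cos be) / (2 * sin e)) in *.
  assert (Hc : 0 < cos e) by (apply cos_gt_0; lra).
  assert (Hs : 0 < sin e) by (apply sin_gt_0; lra).
  pose proof (sin2_cos2 e) as Hsc. unfold Rsqr in Hsc.
  set (z3 := (A, B, sqrt (1 - A ^ 2 - B ^ 2))).
  set (u3 := (cos e, sin e, 0)). set (v3 := (cos e, - sin e, 0)). set (m3 := (1, 0, 0)).
  assert (Oz : on_S2 z3).
  { unfold on_S2, z3, dot3. rewrite sqrt_sqrt by lra. ring. }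
  assert (Ou : on_S2 u3) by (unfold on_S2, u3, dot3; lra).
  assert (Ov : on_S2 v3) by (unfold on_S2, v3, dot3; lra).
  assert (Om : on_S2 m3) by (unfold on_S2, m3, dot3; lra).
  assert (Euv : sdist u3 v3 = d u v).
  { unfold sdist, u3, v3, dot3.
    replace (cos e * cos e + sin e * - sin e + 0 * 0) with (cos (2 * e)).
    - rewrite acos_cos by lra. unfold e. field.
    - rewrite cos_2a. ring. }
  assert (Evz : sdist v3 z3 = d v z).
  { unfold sdist, v3, z3, dot3.
    replace (cos e * A + - sin e * B + 0 * sqrt (1 - A ^ 2 - B ^ 2)) with (cos be).
    - rewrite acos_cos by exact Hbe. unfold be. apply d_sym.
    - unfold A, B. field. lra. }
  assert (Ezu : sdist z3 u3 = d z u).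
  { unfold sdist, u3, z3, dot3.
    replace (A * cos e + B * sin e + sqrt (1 - A ^ 2 - B ^ 2) * 0) with (cos al).
    - rewrite acos_cos by exact Hal. reflexivity.
    - unfold A, B. field. lra. }
  destruct (proj1 d_cat v z Hvz) as [g2 Hg2].
  destruct (proj1 d_cat z u Hzu) as [g3 Hg3].
  assert (Hzz : sdist z3 z3 = 0).
  { unfold sdist. rewrite Oz. apply acos_1. }
  assert (Hcmp : d z (g e) <= sdist z3 m3).
  { apply (proj2 d_cat u v z g g2 g3 Hg Hg2 Hg3 Hper u3 v3 z3 Ou Ov Oz Euv Evz Ezu).
    - right. left. exists (d v z). repeat split; auto.
      + apply d_ge0.
      + lra.
      + symmetry. apply Hg2.
      + rewrite Hzz. ring.
    - left. exists e. repeat split; auto.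
      + lra.
      + unfold e. lra.
      + unfold sdist, u3, m3, dot3.
        replace (cos e * 1 + sin e * 0 + 0 * 0) with (cos e) by ring. apply acos_cos. lra.
      + unfold sdist, v3, m3, dot3.
        replace (1 * cos e + 0 * - sin e + 0 * 0) with (cos e) by ring.
        rewrite acos_cos by lra. unfold e. field. }
  assert (HA1 : -1 <= A <= 1) by (pose proof (pow2_ge_0 B); nra).
  assert (Hcos : A <= cos (d z (g e))).
  { unfold sdist, z3, m3, dot3 in Hcmp.
    replace (A * 1 + B * 0 + sqrt (1 - A ^ 2 - B ^ 2) * 0) with A in Hcmp by ring.
    rewrite <- (cos_acos A HA1).
    pose proof (acos_bound A). apply cos_decr_1; try lra; try apply d_ge0; try apply d_le_PI. }
  replace (cos al + cos be) with (2 * cos e * A); [|unfold A; field; lra].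
  apply Rmult_le_compat_l; lra.
Qed.

Lemma geodesic_dist (x y : X) (g : R -> X) (s t : R) : geodesic d x y g ->
  0 <= s -> s <= t -> t <= d x y -> d (g s) (g t) = t - s.
Proof.
  intros [_ [_ H]] H1 H2 H3. rewrite H by lra. rewrite Rabs_minus_sym. apply Rabs_right. lra.
Qed.

(** A discrete form of h'' + h <= 0 for h = cos (d z (g s)). On a short piece of the geodesic the
    perimeter is at most 2 (d z (g s) + 2 e), so no perimeter bound on the large triangle is
    assumed. *)
Lemma local_comparison (x y z : X) (g : R -> X) (s e : R) : geodesic d x y g ->
  0 < e -> e <= s -> s + e <= d x y -> d z (g s) + 2 * e < PI ->
  cos (d z (g (s - e))) + cos (d z (g (s + e))) <= 2 * cos e * cos (d z (g s)).
Proof.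
  intros Hg He H1 H2 H3.
  pose proof (geodesic_dist x y g (s - e) (s + e) Hg ltac:(lra) ltac:(lra) ltac:(lra)) as Euv.
  pose proof (geodesic_dist x y g (s - e) s Hg ltac:(lra) ltac:(lra) ltac:(lra)) as E1.
  pose proof (geodesic_dist x y g s (s + e) Hg ltac:(lra) ltac:(lra) ltac:(lra)) as E2.
  set (u := g (s - e)) in *. set (v := g (s + e)) in *.
  replace (s + e - (s - e)) with (2 * e) in Euv by ring.
  assert (Hg' : geodesic d u v (fun t => g (s - e + t))).
  { split; [unfold u; f_equal; ring|]. rewrite Euv. split; [unfold v; f_equal; ring|].
    intros a b Ha Hb. destruct Hg as [_ [_ Hg]]. rewrite Hg by lra. f_equal. ring. }
  pose proof (d_tri z (g s) u). pose proof (d_tri z (g s) v).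
  rewrite (d_sym (g s) u) in *.
  pose proof (midpoint_comparison u v z _ Hg') as Hmid.
  rewrite Euv, (d_sym v z) in Hmid. cbv beta in Hmid.
  replace (2 * e / 2) with e in Hmid by field. replace (s - e + e) with s in Hmid by ring.
  apply Hmid; lra.
Qed.

(** A geodesic is controlled only on its interval; precomposing with the clamp gives a function
    continuous on the whole line, to which the extreme value theorem applies at the endpoints
    too. *)
Definition clamp (l s : R) : R := Rmax 0 (Rmin s l).

Lemma clamp_id (l s : R) : 0 <= s <= l -> clamp l s = s.
Proof. intros H. unfold clamp. rewrite Rmin_left, Rmax_right; lra. Qed.

Lemma clamp_range (l s : R) : 0 <= l -> 0 <= clamp l s <= l.
Proof. intros H. unfold clamp, Rmax, Rmin. repeat destruct Rle_dec; lra. Qed.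

Lemma clamp_lip (l s t : R) : 0 <= l -> Rabs (clamp l s - clamp l t) <= Rabs (s - t).
Proof.
  intros H. unfold clamp, Rmax, Rmin, Rabs.
  repeat destruct Rle_dec; repeat destruct Rcase_abs; lra.
Qed.

Lemma dist_along_continuous (x y z : X) (g : R -> X) : geodesic d x y g ->
  continuity (fun s => d z (g (clamp (d x y) s))).
Proof.
  intros Hg s e He. exists e. split; [exact He|]. intros t [_ Ht].
  simpl in *. unfold Rdist in *.
  apply Rle_lt_trans with (2 := Ht).
  pose proof (d_ge0 x y) as Hl.
  apply Rle_trans with (2 := clamp_lip (d x y) t s Hl).
  destruct Hg as [_ [_ Hg]].
  rewrite <- (Hg (clamp (d x y) t) (clamp (d x y) s)) by (apply clamp_range; exact Hl).
  set (a := g (clamp (d x y) t)). set (b := g (clamp (d x y) s)).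
  pose proof (d_tri z a b). pose proof (d_tri z b a). rewrite (d_sym b a) in *.
  apply Rabs_le. lra.
Qed.

(* A negative minimum of (h - H0) / sg would be interior, and there sg'' = - k^2 sg
   with k > 1 contradicts the local form of h'' + h <= 0. *)
Lemma sine_comparison (x y z : X) (g : R -> X) (s : R) : geodesic d x y g ->
  0 < d x y < PI -> 0 <= s <= d x y ->
  cos (d z x) * sin (d x y - s) + cos (d z y) * sin s
    <= sin (d x y) * cos (d z (g s)).
Proof.
  intros Hg Hl Hs. set (l := d x y) in *. pose proof PI_RGT_0.
  assert (Hsl : 0 < sin l) by (apply sin_gt_0; lra).
  (* The mean of 1 and PI / l: thus k > 1, while k l < PI keeps [sg] positive on [0, l]. *)
  set (k := (l + PI) / (2 * l)).
  assert (Ekl : k * l = (l + PI) / 2) by (unfold k; field; lra).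
  assert (Hk : 1 < k).
  { apply Rmult_lt_reg_r with l; lra. }
  set (h := fun s => cos (d z (g (clamp l s)))).
  set (H0 := fun s => (cos (d z x) * sin (l - s) + cos (d z y) * sin s) / sin l).
  set (sg := fun s => cos (k * (s - l / 2))).
  set (G := fun s => (h s - H0 s) / sg s).
  assert (Hsg : forall s, 0 <= s <= l -> 0 < sg s).
  { intros a Ha. unfold sg. apply cos_gt_0; nra. }
  assert (Hcont : forall c, 0 <= c <= l -> continuity_pt G c).
  { intros c Hc. unfold G. apply continuity_pt_div.
    - apply continuity_pt_minus.
      + unfold h. apply (continuity_pt_comp (fun s => d z (g (clamp l s))) cos).
        * apply dist_along_continuous. exact Hg.
        * apply continuity_cos.
      + unfold H0. apply derivable_continuous_pt. reg.
    - unfold sg. apply derivable_continuous_pt. reg.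
    - specialize (Hsg c Hc). lra. }
  destruct (continuity_ab_min G 0 l ltac:(lra) Hcont) as [m [Hmin Hm]].
  assert (Hh : forall a, 0 <= a <= l -> h a = cos (d z (g a))).
  { intros a Ha. unfold h. rewrite clamp_id by exact Ha. reflexivity. }
  assert (HG : forall a, 0 <= a <= l -> h a - H0 a = G a * sg a).
  { intros a Ha. unfold G. field. specialize (Hsg a Ha). lra. }
  assert (Hmge : 0 <= G m).
  { destruct (Rle_or_lt 0 (G m)) as [|Hneg]; [assumption|exfalso].
    pose proof (HG m Hm) as Em. pose proof (Hsg m Hm) as Sm.
    assert (Elt : h m - H0 m < 0) by nra.
    assert (Hm0 : m <> 0).
    { intros ->. revert Elt. rewrite Hh by lra. unfold H0. rewrite sin_0, Rminus_0_r.
      replace (g 0) with x by (symmetry; apply Hg).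
      replace ((cos (d z x) * sin l + cos (d z y) * 0) / sin l) with (cos (d z x)) by (field; lra).
      lra. }
    assert (Hml : m <> l).
    { intros ->. revert Elt. rewrite Hh by lra. unfold H0.
      replace (l - l) with 0 by ring. rewrite sin_0.
      replace (g l) with y by (symmetry; apply Hg).
      replace ((cos (d z x) * 0 + cos (d z y) * sin l) / sin l) with (cos (d z y)) by (field; lra).
      lra. }
    rewrite (Hh m Hm) in *.
    pose proof (d_le_PI z (g m)) as Hd.
    destruct (Rle_lt_or_eq_dec _ _ Hd) as [Hdlt|Hdeq].
    - set (e := Rmin (Rmin m (l - m)) (Rmin ((PI - d z (g m)) / 4) (PI / (2 * k)))).
      assert (Hkp : 0 < PI / (2 * k)) by (apply Rdiv_lt_0_compat; lra).
      assert (He : 0 < e) by (unfold e; repeat apply Rmin_glb_lt; lra).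
      assert (He1 : e <= m).
      { unfold e. eapply Rle_trans; [apply Rmin_l|apply Rmin_l]. }
      assert (He2 : e <= l - m).
      { unfold e. eapply Rle_trans; [apply Rmin_l|apply Rmin_r]. }
      assert (He3 : e <= (PI - d z (g m)) / 4).
      { unfold e. eapply Rle_trans; [apply Rmin_r|apply Rmin_l]. }
      assert (He4 : k * e <= PI / 2).
      { replace (PI / 2) with (k * (PI / (2 * k))) by (field; lra).
        apply Rmult_le_compat_l; [lra|]. unfold e. eapply Rle_trans; [apply Rmin_r|apply Rmin_r]. }
      pose proof (local_comparison x y z g m e Hg He He1 ltac:(fold l; lra) ltac:(lra)) as Hloc.
      rewrite <- (Hh (m - e)), <- (Hh (m + e)) in Hloc by lra.
      assert (EH : H0 (m - e) + H0 (m + e) = 2 * cos e * H0 m).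
      { unfold H0. replace (l - (m - e)) with ((l - m) + e) by ring.
        replace (l - (m + e)) with ((l - m) - e) by ring.
        rewrite !sin_plus, !sin_minus. field. lra. }
      assert (ES : sg (m - e) + sg (m + e) = 2 * cos (k * e) * sg m).
      { unfold sg. replace (k * (m - e - l / 2)) with (k * (m - l / 2) - k * e) by ring.
        replace (k * (m + e - l / 2)) with (k * (m - l / 2) + k * e) by ring.
        rewrite cos_plus, cos_minus. ring. }
      pose proof (HG (m - e) ltac:(lra)) as G1. pose proof (HG (m + e) ltac:(lra)) as G2.
      pose proof (Hmin (m - e) ltac:(lra)) as M1. pose proof (Hmin (m + e) ltac:(lra)) as M2.
      pose proof (Hsg (m - e) ltac:(lra)) as S1. pose proof (Hsg (m + e) ltac:(lra)) as S2.
      (* Minimality of G at m and the local inequality at m - e and m + e combine; as G m < 0, this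
         would give cos (k e) >= cos e. *)
      assert (Hlow : G m * (2 * cos (k * e) * sg m) <= 2 * cos e * (G m * sg m)).
      { rewrite <- ES, <- Em. nra. }
      assert (Hcc : cos (k * e) < cos e) by (apply cos_decreasing_1; nra).
      assert (G m * sg m < 0) by nra. nra.
    - rewrite Hdeq, cos_PI in Elt.
      pose proof (geodesic_dist x y g 0 m Hg ltac:(lra) ltac:(lra) ltac:(fold l; lra)) as D1.
      pose proof (geodesic_dist x y g m l Hg ltac:(lra) ltac:(lra) ltac:(fold l; lra)) as D2.
      replace (g 0) with x in D1 by (symmetry; apply Hg).
      replace (g l) with y in D2 by (symmetry; apply Hg).
      pose proof (d_tri z x (g m)). pose proof (d_tri z y (g m)). rewrite (d_sym y) in *.
      assert (C1 : cos (d z x) <= - cos m).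
      { replace (- cos m) with (cos (PI - m)) by (rewrite cos_minus, cos_PI, sin_PI; ring).
        apply cos_decr_1; try lra; first [apply d_ge0 | apply d_le_PI]. }
      assert (C2 : cos (d z y) <= - cos (l - m)).
      { replace (- cos (l - m)) with (cos (PI - (l - m)))
          by (rewrite (cos_minus PI), cos_PI, sin_PI; ring).
        apply cos_decr_1; try lra; first [apply d_ge0 | apply d_le_PI]. }
      assert (S1 : 0 <= sin (l - m)) by (apply sin_ge_0; lra).
      assert (S2 : 0 <= sin m) by (apply sin_ge_0; lra).
      assert (HH : H0 m <= -1); [|lra].
      unfold H0. apply Rmult_le_reg_r with (sin l); [exact Hsl|].
      unfold Rdiv. rewrite Rmult_assoc, Rinv_l by lra.
      assert (Esl : sin l = sin (l - m) * cos m + cos (l - m) * sin m).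
      { rewrite <- sin_plus. f_equal. ring. }
      rewrite Esl. nra. }
  pose proof (Hmin s Hs) as Ms. pose proof (HG s Hs) as Es. pose proof (Hsg s Hs) as Ss.
  assert (Hge : H0 s <= h s) by nra.
  rewrite (Hh s Hs) in Hge. unfold H0 in Hge.
  apply (Rmult_le_compat_l (sin l)) in Hge; [|lra].
  replace (sin l * ((cos (d z x) * sin (l - s) + cos (d z y) * sin s) / sin l))
    with (cos (d z x) * sin (l - s) + cos (d z y) * sin s) in Hge by (field; lra).
  exact Hge.
Qed.

(* (a, m) is the sum of the vectors r x and s y in the cone over X; superadditivity
   of the inner product with z is all that remains of linearity. *)
Lemma cone_sum_exists (r s : R) (x y : X) : 0 <= r -> 0 <= s ->
  exists (a : R) (m : X), 0 <= a /\
    a ^ 2 <= r ^ 2 + s ^ 2 + 2 * r * s * cos (d x y) /\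
    forall z, r * cos (d z x) + s * cos (d z y) <= a * cos (d z m).
Proof.
  intros Hr Hs. pose proof PI_RGT_0.
  destruct (Rle_lt_or_eq_dec _ _ (d_ge0 x y)) as [Hpos|Hzero].
  2: { assert (x = y) as -> by (apply d_met; auto).
       exists (r + s), y. rewrite d_refl, cos_0. repeat split; intros; nra. }
  destruct (Rle_lt_or_eq_dec _ _ Hs) as [Hs'|Hs'].
  2: { exists r, x. subst s. repeat split; intros; nra. }
  destruct (Rle_lt_or_eq_dec _ _ Hr) as [Hr'|Hr'].
  2: { exists s, y. subst r. repeat split; intros; nra. }
  destruct (Rle_lt_or_eq_dec _ _ (d_le_PI x y)) as [Hlt|Heq].
  - set (l := d x y) in *.
    assert (Hsl : 0 < sin l) by (apply sin_gt_0; lra).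
    pose proof (sin2_cos2 l) as Hsc. unfold Rsqr in Hsc.
    (* Planar model: add (r, 0) and s (cos l, sin l). The sum has polar coordinates a and t, and its
       direction is the point at parameter t on the geodesic from x to y. *)
    set (q := r ^ 2 + s ^ 2 + 2 * r * s * cos l).
    assert (Eq : q = (r + s * cos l) ^ 2 + (s * sin l) ^ 2).
    { unfold q. assert (sin l * sin l = 1 - cos l * cos l) by lra. nra. }
    assert (Hq : 0 < q).
    { rewrite Eq. assert (0 < s * sin l) by nra. pose proof (pow2_ge_0 (r + s * cos l)). nra. }
    set (a := sqrt q). assert (Ha : 0 < a) by (apply sqrt_lt_R0; exact Hq).
    assert (Ea : a ^ 2 = q) by (unfold a; simpl; rewrite Rmult_1_r; apply sqrt_sqrt; lra).
    set (c := (r + s * cos l) / a).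
    assert (Ec : a * c = r + s * cos l) by (unfold c; field; lra).
    assert (Hc : -1 <= c <= 1).
    { assert (c ^ 2 <= 1); [|nra].
      apply Rmult_le_reg_l with (a ^ 2); [nra|].
      replace (a ^ 2 * c ^ 2) with ((r + s * cos l) ^ 2) by (rewrite <- Ec; ring).
      rewrite Ea, Eq. pose proof (pow2_ge_0 (s * sin l)). lra. }
    set (t := acos c). pose proof (acos_bound c) as Ht. fold t in Ht.
    assert (Ect : a * cos t = r + s * cos l) by (unfold t; rewrite cos_acos; auto).
    assert (Est : a * sin t = s * sin l).
    { assert (0 <= sin t) by (apply sin_ge_0; lra).
      pose proof (sin2_cos2 t) as Hsct. unfold Rsqr in Hsct.
      assert ((a * sin t) ^ 2 = (s * sin l) ^ 2).
      { replace ((a * sin t) ^ 2) with (a ^ 2 * (sin t * sin t)) by ring.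
        replace (sin t * sin t) with (1 - cos t * cos t) by lra.
        replace (a ^ 2 * (1 - cos t * cos t)) with (a ^ 2 - (a * cos t) ^ 2) by ring.
        rewrite Ea, Ect, Eq. ring. }
      assert (0 <= a * sin t) by nra. assert (0 <= s * sin l) by nra. nra. }
    assert (Elt : a * sin (l - t) = r * sin l).
    { rewrite sin_minus.
      replace (a * (sin l * cos t - cos l * sin t))
        with (sin l * (a * cos t) - cos l * (a * sin t)) by ring.
      rewrite Ect, Est. ring. }
    assert (Htl : t <= l).
    { destruct (Rle_or_lt t l) as [|Hgt]; [assumption|exfalso].
      assert (0 < sin (t - l)) by (apply sin_gt_0; lra).
      replace (sin (l - t)) with (- sin (t - l)) in Elt by (rewrite <- sin_neg; f_equal; ring).
      nra. }
    destruct (proj1 d_cat x y Hlt) as [g Hg].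
    exists a, (g t). split; [lra|]. split; [rewrite Ea; unfold q; lra|].
    intros z. pose proof (sine_comparison x y z g t Hg ltac:(fold l; lra) ltac:(fold l; lra)) as H1.
    fold l in H1. apply Rmult_le_reg_l with (sin l); [exact Hsl|].
    apply (Rmult_le_compat_l a) in H1; [|lra].
    replace (a * (cos (d z x) * sin (l - t) + cos (d z y) * sin t))
      with (cos (d z x) * (a * sin (l - t)) + cos (d z y) * (a * sin t)) in H1 by ring.
    rewrite Elt, Est in H1. lra.
  - assert (Hz : forall z, cos (d z x) + cos (d z y) <= 0).
    { intros z. pose proof (d_tri x z y). rewrite (d_sym x z) in *.
      assert (cos (d z y) <= cos (PI - d z x)).
      { pose proof (d_ge0 z x). pose proof (d_ge0 z y). pose proof (d_le_PI z x).
        pose proof (d_le_PI z y). apply cos_decr_1; lra. }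
      rewrite cos_minus, cos_PI, sin_PI in *. lra. }
    rewrite Heq, cos_PI.
    destruct (Rle_or_lt s r).
    + exists (r - s), x. repeat split; [lra|nra|]. intros z. specialize (Hz z). nra.
    + exists (s - r), y. repeat split; [lra|nra|]. intros z. specialize (Hz z). nra.
Qed.

(** * The cone over the ultracompletion *)

(** The triangle inequality for the plane points with polar coordinates (r, al), (s, 0), (q, -be).
    The weighted form is linear in squared distances and therefore passes to ultralimits. *)
Lemma planar_triangle (r s q al be th : R) : 0 < th < 1 ->
  r ^ 2 + q ^ 2 - 2 * (r * q * cos (al + be))
    <= (r ^ 2 + s ^ 2 - 2 * (r * s * cos al)) / th
       + (s ^ 2 + q ^ 2 - 2 * (s * q * cos be)) / (1 - th).
Proof.
  intros Hth. rewrite cos_plus.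
  assert (Ea : sin al ^ 2 = 1 - cos al ^ 2) by (pose proof (sin2_cos2 al); unfold Rsqr in *; lra).
  assert (Eb : sin be ^ 2 = 1 - cos be ^ 2) by (pose proof (sin2_cos2 be); unfold Rsqr in *; lra).
  set (X1 := r * cos al - s). set (Y1 := r * sin al).
  set (X2 := s - q * cos be). set (Y2 := q * sin be).
  replace (r ^ 2 + s ^ 2 - 2 * (r * s * cos al)) with (X1 ^ 2 + Y1 ^ 2).
  2: { unfold X1, Y1. rewrite (Rpow_mult_distr r), Ea. ring. }
  replace (s ^ 2 + q ^ 2 - 2 * (s * q * cos be)) with (X2 ^ 2 + Y2 ^ 2).
  2: { unfold X2, Y2. rewrite (Rpow_mult_distr q), Eb. ring. }
  replace (r ^ 2 + q ^ 2 - 2 * (r * q * (cos al * cos be - sin al * sin be)))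
    with ((X1 + X2) ^ 2 + (Y1 + Y2) ^ 2).
  2: { unfold X1, X2, Y1, Y2.
       replace ((r * sin al + q * sin be) ^ 2)
         with (r ^ 2 * sin al ^ 2 + q ^ 2 * sin be ^ 2 + 2 * (r * q * (sin al * sin be))) by ring.
       rewrite Ea, Eb. ring. }
  assert (E : (X1 ^ 2 + Y1 ^ 2) / th + (X2 ^ 2 + Y2 ^ 2) / (1 - th)
      - ((X1 + X2) ^ 2 + (Y1 + Y2) ^ 2)
    = (((1 - th) * X1 - th * X2) ^ 2 + ((1 - th) * Y1 - th * Y2) ^ 2) / (th * (1 - th)))
    by (field; lra).
  assert (0 <= (((1 - th) * X1 - th * X2) ^ 2 + ((1 - th) * Y1 - th * Y2) ^ 2) / (th * (1 - th))).
  { apply Rle_mult_inv_pos; [|nra].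
    pose proof (pow2_ge_0 ((1 - th) * X1 - th * X2)).
    pose proof (pow2_ge_0 ((1 - th) * Y1 - th * Y2)). lra. }
  lra.
Qed.

(** If the two angles add up to more than PI, lowering the second to PI - d x y only decreases the
    right side, and the left side never exceeds its value at angle PI. *)
Lemma cone_triangle (r s q th : R) (x y z : X) : 0 <= r -> 0 <= s -> 0 <= q -> 0 < th < 1 ->
  r ^ 2 + q ^ 2 - 2 * (r * q * cos (d x z))
    <= (r ^ 2 + s ^ 2 - 2 * (r * s * cos (d x y))) / th
       + (s ^ 2 + q ^ 2 - 2 * (s * q * cos (d y z))) / (1 - th).
Proof.
  intros Hr Hs Hq Hth. pose proof PI_RGT_0.
  pose proof (d_ge0 x y). pose proof (d_ge0 y z). pose proof (d_ge0 x z).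
  pose proof (d_le_PI x y). pose proof (d_le_PI y z). pose proof (d_le_PI x z).
  assert (Hrq : 0 <= r * q) by nra.
  destruct (Rle_or_lt (d x y + d y z) PI) as [Hle|Hgt].
  - apply Rle_trans with (2 := planar_triangle r s q (d x y) (d y z) th Hth).
    assert (cos (d x y + d y z) <= cos (d x z)).
    { pose proof (d_tri x y z). apply cos_decr_1; lra. }
    nra.
  - pose proof (planar_triangle r s q (d x y) (PI - d x y) th Hth) as Hp.
    replace (d x y + (PI - d x y)) with PI in Hp by ring. rewrite cos_PI in Hp.
    assert (Hc : cos (d y z) <= cos (PI - d x y)) by (apply cos_decr_1; lra).
    pose proof (COS_bound (d x z)).
    assert ((s ^ 2 + q ^ 2 - 2 * (s * q * cos (PI - d x y))) / (1 - th)
      <= (s ^ 2 + q ^ 2 - 2 * (s * q * cos (d y z))) / (1 - th)).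
    { apply Rmult_le_compat_r; [left; apply Rinv_0_lt_compat; lra|].
      assert (0 <= s * q) by nra. nra. }
    nra.
Qed.

(* Points of the cone over the ultracompletion are represented by bounded
   sequences of points (radius, direction) of the cone over X. *)
Record cone_seq : Type := ConeSeq {
  rad : nat -> R;
  dir : nat -> X;
  rad_ge0 : forall n, 0 <= rad n;
  rad_bound : exists B, forall n, rad n <= B }.

Definition cker (u v : cone_seq) (n : nat) : R :=
  rad u n * rad v n * cos (d (dir u n) (dir v n)).

Definition csq (u v : cone_seq) (n : nat) : R :=
  cker u u n + cker v v n - 2 * cker u v n.

Lemma cker_diag (u : cone_seq) (n : nat) : cker u u n = rad u n ^ 2.
Proof. unfold cker. rewrite d_refl, cos_0. ring. Qed.

Lemma cker_sym (u v : cone_seq) (n : nat) : cker u v n = cker v u n.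
Proof. unfold cker. rewrite d_sym. ring. Qed.

Lemma cker_bounded (u v : cone_seq) : exists B, forall n, Rabs (cker u v n) <= B.
Proof.
  destruct (rad_bound u) as [Bu Hu]. destruct (rad_bound v) as [Bv Hv].
  exists (Bu * Bv). intros n. unfold cker.
  pose proof (rad_ge0 u n). pose proof (rad_ge0 v n). specialize (Hu n). specialize (Hv n).
  assert (0 <= rad u n * rad v n <= Bu * Bv) by (split; [nra|apply Rmult_le_compat; auto]).
  pose proof (COS_bound (d (dir u n) (dir v n))).
  apply Rabs_le. split; nra.
Qed.

Lemma csq_eq (u v : cone_seq) (n : nat) : csq u v n
  = (rad u n - rad v n) ^ 2 + 2 * (rad u n * rad v n) * (1 - cos (d (dir u n) (dir v n))).
Proof. unfold csq. rewrite !cker_diag. unfold cker. ring. Qed.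

Lemma csq_ge_rad (u v : cone_seq) (n : nat) : (rad u n - rad v n) ^ 2 <= csq u v n.
Proof.
  rewrite csq_eq. pose proof (rad_ge0 u n). pose proof (rad_ge0 v n).
  assert (0 <= rad u n * rad v n) by nra.
  pose proof (COS_bound (d (dir u n) (dir v n))). nra.
Qed.

Lemma csq_ge0 (u v : cone_seq) (n : nat) : 0 <= csq u v n.
Proof. pose proof (csq_ge_rad u v n). pose proof (pow2_ge_0 (rad u n - rad v n)). lra. Qed.

Variable w : (nat -> Prop) -> Prop.
Hypothesis w_ultra : ultrafilter w.
Hypothesis w_np : nonprincipal w.

Lemma cip_exists (u v : cone_seq) : exists L, ulim w (cker u v) L.
Proof.
  destruct (cker_bounded u v) as [B HB]. apply ulim_exists with B; auto.
Qed.

Definition cip (u v : cone_seq) : R :=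
  proj1_sig (constructive_indefinite_description _ (cip_exists u v)).

Lemma cip_ulim (u v : cone_seq) : ulim w (cker u v) (cip u v).
Proof. unfold cip. destruct constructive_indefinite_description. auto. Qed.

Lemma cip_eq (u v : cone_seq) (L : R) : ulim w (cker u v) L -> cip u v = L.
Proof. intros H. apply (ulim_unique w w_ultra (cker u v)); [apply cip_ulim|exact H]. Qed.

Lemma cip_sym (u v : cone_seq) : cip u v = cip v u.
Proof.
  apply cip_eq. apply (ulim_ext w w_ultra (cker v u)); [apply cker_sym|apply cip_ulim].
Qed.

Definition cdist (u v : cone_seq) : R := sqrt (cip u u + cip v v - 2 * cip u v).

Lemma csq_ulim (u v : cone_seq) : ulim w (csq u v) (cip u u + cip v v - 2 * cip u v).
Proof.
  apply (ulim_ext w w_ultra (fun n => (cker u u n + cker v v n) + (-2) * cker u v n)).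
  - intros n. unfold csq. ring.
  - replace (cip u u + cip v v - 2 * cip u v)
      with ((cip u u + cip v v) + (-2) * cip u v) by ring.
    apply ulim_plus; [exact w_ultra|apply ulim_plus; auto; apply cip_ulim|].
    apply ulim_scal; [exact w_ultra|apply cip_ulim].
Qed.

Lemma cdist_sq (u v : cone_seq) : cdist u v ^ 2 = cip u u + cip v v - 2 * cip u v.
Proof.
  unfold cdist. simpl. rewrite Rmult_1_r. apply sqrt_sqrt.
  apply (ulim_le w w_ultra (fun _ => 0) (csq u v)); [apply ulim_const; auto|apply csq_ulim|].
  apply w_all; [exact w_ultra|]. apply csq_ge0.
Qed.

Lemma cdist_ulim (u v : cone_seq) : ulim w (csq u v) (cdist u v ^ 2).
Proof. rewrite cdist_sq. apply csq_ulim. Qed.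

Lemma cdist_ge0 (u v : cone_seq) : 0 <= cdist u v.
Proof. apply sqrt_pos. Qed.

Lemma cdist_sym (u v : cone_seq) : cdist u v = cdist v u.
Proof. unfold cdist. rewrite (cip_sym u v). f_equal. ring. Qed.

Lemma cdist_refl (u : cone_seq) : cdist u u = 0.
Proof. unfold cdist. rewrite <- sqrt_0. f_equal. ring. Qed.

Lemma cdist_le (u v : cone_seq) (c : R) : 0 <= c ->
  w (fun n => csq u v n <= c ^ 2) -> cdist u v <= c.
Proof.
  intros Hc H. apply le_of_sqr_le; [exact Hc|].
  apply (ulim_le w w_ultra (csq u v) (fun _ => c ^ 2)); auto.
  - apply cdist_ulim.
  - apply ulim_const. exact w_ultra.
Qed.

Lemma cdist_lt (u v : cone_seq) (c : R) : cdist u v < c -> w (fun n => csq u v n < c ^ 2).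
Proof.
  intros H. pose proof (cdist_ge0 u v).
  assert (He : 0 < c ^ 2 - cdist u v ^ 2) by nra.
  apply (w_mono w w_ultra) with (1 := cdist_ulim u v _ He).
  intros n Hn. apply Rabs_def2 in Hn. lra.
Qed.

Lemma cdist_tri_weighted (u v z : cone_seq) (t : R) : 0 < t < 1 ->
  cdist u z ^ 2 <= cdist u v ^ 2 / t + cdist v z ^ 2 / (1 - t).
Proof.
  intros Ht.
  apply (ulim_le w w_ultra (csq u z) (fun n => / t * csq u v n + / (1 - t) * csq v z n)).
  - apply cdist_ulim.
  - replace (cdist u v ^ 2 / t + cdist v z ^ 2 / (1 - t))
      with (/ t * cdist u v ^ 2 + / (1 - t) * cdist v z ^ 2) by (unfold Rdiv; ring).
    apply ulim_plus; [exact w_ultra| |]; apply ulim_scal; auto; apply cdist_ulim.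
  - apply w_all; [exact w_ultra|]. intros n. unfold csq. rewrite !cker_diag.
    rewrite (Rmult_comm (/ t)), (Rmult_comm (/ (1 - t))).
    apply cone_triangle; auto using rad_ge0.
Qed.

Lemma cdist_tri (u v z : cone_seq) : cdist u z <= cdist u v + cdist v z.
Proof.
  set (a := cdist u v). set (b := cdist v z).
  assert (Ha : 0 <= a) by apply cdist_ge0. assert (Hb : 0 <= b) by apply cdist_ge0.
  apply le_of_sqr_le; [lra|].
  apply Rle_of_eps with (c := 2 * (a + b)). intros e He.
  (* The optimal weight is a / (a + b); e keeps it inside (0, 1) when a or b vanishes. *)
  set (t := (a + e) / (a + b + 2 * e)).
  assert (E1 : 1 - t = (b + e) / (a + b + 2 * e)) by (unfold t; field; lra).
  assert (Ht : 0 < t < 1).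
  { assert (0 < 1 - t) by (rewrite E1; apply Rdiv_lt_0_compat; lra).
    split; [apply Rdiv_lt_0_compat; lra|lra]. }
  pose proof (cdist_tri_weighted u v z t Ht) as H. fold a b in H.
  assert (H1 : a ^ 2 / t <= (a + b + 2 * e) * a).
  { apply Rmult_le_reg_r with t; [lra|]. unfold Rdiv. rewrite Rmult_assoc, Rinv_l by lra.
    replace ((a + b + 2 * e) * a * t) with (a * (a + e)) by (unfold t; field; lra). nra. }
  assert (H2 : b ^ 2 / (1 - t) <= (a + b + 2 * e) * b).
  { apply Rmult_le_reg_r with (1 - t); [lra|]. unfold Rdiv. rewrite Rmult_assoc, Rinv_l by lra.
    replace ((a + b + 2 * e) * b * (1 - t)) with (b * (b + e)) by (rewrite E1; field; lra). nra. }
  nra.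
Qed.

(** * Convex combinations in the cone over the ultracompletion *)

Lemma cone_sum_choice : exists sum : R -> X -> R -> X -> R * X,
  forall r x s y, 0 <= r -> 0 <= s ->
    0 <= fst (sum r x s y) /\
    fst (sum r x s y) ^ 2 <= r ^ 2 + s ^ 2 + 2 * r * s * cos (d x y) /\
    forall z, r * cos (d z x) + s * cos (d z y)
      <= fst (sum r x s y) * cos (d z (snd (sum r x s y))).
Proof.
  assert (H : forall q : (R * X) * (R * X), exists am : R * X,
    0 <= fst (fst q) -> 0 <= fst (snd q) -> 0 <= fst am /\
    fst am ^ 2 <= fst (fst q) ^ 2 + fst (snd q) ^ 2
      + 2 * fst (fst q) * fst (snd q) * cos (d (snd (fst q)) (snd (snd q))) /\
    forall z, fst (fst q) * cos (d z (snd (fst q))) + fst (snd q) * cos (d z (snd (snd q)))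
      <= fst am * cos (d z (snd am))).
  { intros [[r x] [s y]]. simpl.
    destruct (classic (0 <= r /\ 0 <= s)) as [[Hr Hs]|Hn].
    - destruct (cone_sum_exists r s x y Hr Hs) as [a [m Ham]]. exists (a, m). auto.
    - exists (r, x). tauto. }
  exists (fun r x s y =>
    proj1_sig (constructive_indefinite_description _ (H ((r, x), (s, y))))).
  intros r x s y. destruct constructive_indefinite_description as [am Ham]. exact Ham.
Qed.

(** One function is chosen for all pairs of vectors, so that constant sequences have constant sums;
    the convexity of [base_cone] rests on this. *)
Definition cone_sum : R -> X -> R -> X -> R * X :=
  proj1_sig (constructive_indefinite_description _ cone_sum_choice).

Lemma cone_sum_spec (r s : R) (x y : X) : 0 <= r -> 0 <= s ->
  0 <= fst (cone_sum r x s y) /\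
  fst (cone_sum r x s y) ^ 2 <= r ^ 2 + s ^ 2 + 2 * r * s * cos (d x y) /\
  forall z, r * cos (d z x) + s * cos (d z y)
    <= fst (cone_sum r x s y) * cos (d z (snd (cone_sum r x s y))).
Proof.
  unfold cone_sum. destruct (constructive_indefinite_description _ cone_sum_choice) as [f Hf].
  apply Hf.
Qed.

Definition cadd (u v : cone_seq) : cone_seq.
Proof.
  refine (ConeSeq (fun n => fst (cone_sum (rad u n) (dir u n) (rad v n) (dir v n)))
    (fun n => snd (cone_sum (rad u n) (dir u n) (rad v n) (dir v n))) _ _).
  - intros n. apply cone_sum_spec; apply rad_ge0.
  - destruct (rad_bound u) as [Bu Hu]. destruct (rad_bound v) as [Bv Hv].
    exists (Bu + Bv). intros n. specialize (Hu n). specialize (Hv n).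
    pose proof (rad_ge0 u n) as Ru. pose proof (rad_ge0 v n) as Rv.
    destruct (cone_sum_spec (rad u n) (rad v n) (dir u n) (dir v n) Ru Rv) as [_ [H _]].
    apply Rle_trans with (rad u n + rad v n); [|lra].
    apply le_of_sqr_le; [lra|]. apply Rle_trans with (1 := H).
    pose proof (COS_bound (d (dir u n) (dir v n))). assert (0 <= rad u n * rad v n) by nra. nra.
Defined.

(* The absolute value only makes the operation total; it is used for l >= 0. *)
Definition cscal (l : R) (u : cone_seq) : cone_seq.
Proof.
  refine (ConeSeq (fun n => Rabs l * rad u n) (dir u) _ _).
  - intros n. apply Rmult_le_pos; [apply Rabs_pos|apply rad_ge0].
  - destruct (rad_bound u) as [B HB]. exists (Rabs l * B). intros n.
    apply Rmult_le_compat_l; [apply Rabs_pos|apply HB].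
Defined.

Definition ccomb (t : R) (u v : cone_seq) : cone_seq :=
  cadd (cscal (1 - t) u) (cscal t v).

Lemma cip_scal (l : R) (u v : cone_seq) : 0 <= l -> cip u (cscal l v) = l * cip u v.
Proof.
  intros Hl. apply cip_eq. apply (ulim_ext w w_ultra (fun n => l * cker u v n)).
  - intros n. unfold cker. simpl. rewrite Rabs_pos_eq by exact Hl. ring.
  - apply ulim_scal; [exact w_ultra|apply cip_ulim].
Qed.

Lemma cip_comb (t : R) (u v z : cone_seq) : 0 <= t <= 1 ->
  (1 - t) * cip z u + t * cip z v <= cip z (ccomb t u v).
Proof.
  intros Ht.
  apply (ulim_le w w_ultra (fun n => (1 - t) * cker z u n + t * cker z v n)
    (cker z (ccomb t u v))).
  - apply ulim_plus; [exact w_ultra| |]; apply ulim_scal; auto; apply cip_ulim.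
  - apply cip_ulim.
  - apply w_all; [exact w_ultra|]. intros n. unfold cker. simpl.
    rewrite !Rabs_pos_eq by lra.
    pose proof (rad_ge0 u n). pose proof (rad_ge0 v n). pose proof (rad_ge0 z n) as Hz.
    destruct (cone_sum_spec ((1 - t) * rad u n) (t * rad v n) (dir u n) (dir v n))
      as [_ [_ H1]]; [nra|nra|].
    specialize (H1 (dir z n)). apply (Rmult_le_compat_l _ _ _ Hz) in H1. nra.
Qed.

Lemma cip_comb_diag (t : R) (u v : cone_seq) : 0 <= t <= 1 ->
  cip (ccomb t u v) (ccomb t u v)
    <= (1 - t) ^ 2 * cip u u + t ^ 2 * cip v v + 2 * t * (1 - t) * cip u v.
Proof.
  intros Ht.
  apply (ulim_le w w_ultra (cker (ccomb t u v) (ccomb t u v))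
    (fun n => (1 - t) ^ 2 * cker u u n + t ^ 2 * cker v v n + 2 * t * (1 - t) * cker u v n)).
  - apply cip_ulim.
  - repeat apply ulim_plus; try exact w_ultra; apply ulim_scal; auto; apply cip_ulim.
  - apply w_all; [exact w_ultra|]. intros n. rewrite !cker_diag. unfold cker. simpl rad.
    rewrite !Rabs_pos_eq by lra.
    pose proof (rad_ge0 u n). pose proof (rad_ge0 v n).
    destruct (cone_sum_spec ((1 - t) * rad u n) (t * rad v n) (dir u n) (dir v n))
      as [_ [H1 _]]; [nra|nra|].
    apply Rle_trans with (1 := H1). right. ring.
Qed.

(** Expand the squares: [cip_comb] controls the cross term with z, [cip_comb_diag] the norm of the
    combination, and the remaining terms match as in a Euclidean plane. *)
Lemma ccomb_npc (t : R) (u v z : cone_seq) : 0 <= t <= 1 ->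
  cdist z (ccomb t u v) ^ 2
    <= (1 - t) * cdist z u ^ 2 + t * cdist z v ^ 2 - t * (1 - t) * cdist u v ^ 2.
Proof.
  intros Ht. rewrite !cdist_sq.
  pose proof (cip_comb t u v z Ht). pose proof (cip_comb_diag t u v Ht). nra.
Qed.

(** * Completeness of the cone over the ultracompletion *)

Lemma max_index_exists (P : nat -> Prop) (n : nat) : P O ->
  exists k, P k /\ forall j, (j <= n)%nat -> P j -> (j <= k)%nat.
Proof.
  intros H0. induction n as [|n [k [Hk1 Hk2]]].
  - exists O. split; [exact H0|auto].
  - destruct (classic (P (S n))) as [H|H].
    + exists (S n). auto.
    + exists k. split; [exact Hk1|]. intros j Hj HPj.
      destruct (Nat.eq_dec j (S n)) as [->|]; [contradiction|apply Hk2; [lia|exact HPj]].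
Qed.

Lemma fast_subsequence (Z : Type) (D : Z -> Z -> R) (u : nat -> Z) : cauchy_seq D u ->
  exists M : nat -> nat, forall i m n, (M i <= m)%nat -> (M i <= n)%nat ->
    (forall j, (i <= j)%nat -> (M i <= M j)%nat) /\ D (u m) (u n) < / 2 ^ i.
Proof.
  intros Hc.
  assert (H : forall i, exists N, forall m n, (N <= m)%nat -> (N <= n)%nat ->
    D (u m) (u n) < / 2 ^ i).
  { intros i. apply Hc. apply Rinv_0_lt_compat, pow_lt. lra. }
  set (N := fun i => proj1_sig (constructive_indefinite_description _ (H i))).
  assert (HN : forall i m n, (N i <= m)%nat -> (N i <= n)%nat -> D (u m) (u n) < / 2 ^ i).
  { intros i. unfold N. destruct (constructive_indefinite_description _ (H i)). auto. }
  set (M := fix M i := match i with O => N O | S j => max (M j) (N (S j)) end).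
  assert (HNM : forall i, (N i <= M i)%nat) by (intros [|i]; simpl; lia).
  assert (HM : forall i k, (M i <= M (k + i))%nat).
  { intros i k. induction k as [|k IH]; simpl; lia. }
  exists M. intros i m n Hm Hn. specialize (HNM i). split.
  - intros j Hj. replace j with ((j - i) + i)%nat by lia. apply HM.
  - apply HN; lia.
Qed.

(* The limit is read off diagonally: its n-th entry is that of the latest term
   (with index at most n) up to which the n-th entries behave like a Cauchy sequence. *)
Lemma cone_seq_complete : complete_set cone_seq cdist (fun _ => True).
Proof.
  intros u _ Hc. destruct (fast_subsequence _ _ _ Hc) as [M HM].
  set (v := fun k => u (M k)).
  assert (Hv : forall i j, (i <= j)%nat -> cdist (v i) (v j) < / 2 ^ i).
  { intros i j Hij. destruct (HM i (M i) (M i)) as [H1 _]; auto.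
    apply HM; auto. }
  set (good := fun n k => (k <= n)%nat /\ forall i j, (i <= j)%nat -> (j <= k)%nat ->
    csq (v i) (v j) n < (/ 2 ^ i) ^ 2).
  assert (good0 : forall n, good n O).
  { intros n. split; [lia|]. intros i j Hij Hj. replace i with O by lia. replace j with O by lia.
    unfold csq. simpl. lra. }
  assert (Hgood : forall k, w (fun n => good n k)).
  { intros k.
    apply (w_mono w w_ultra) with (fun n => (k <= n)%nat /\
      forall i, (i < S k)%nat -> forall j, (j < S k)%nat -> (i <= j)%nat ->
        csq (v i) (v j) n < (/ 2 ^ i) ^ 2).
    - apply w_and; [exact w_ultra|apply w_ge; auto|].
      apply (w_forall_lt w w_ultra (fun i n => forall j, (j < S k)%nat -> (i <= j)%nat -> _)).
      intros i _.
      apply (w_forall_lt w w_ultra (fun j n => (i <= j)%nat -> _)). intros j _.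
      destruct (Nat.le_gt_cases i j) as [Hij|Hij].
      + apply (w_mono w w_ultra) with (1 := cdist_lt _ _ _ (Hv i j Hij)). auto.
      + apply w_all; [exact w_ultra|]. intros n Hn. lia.
    - intros n [H1 H2]. split; [exact H1|]. intros i j Hij Hj. apply H2; lia. }
  set (kap := fun n =>
    proj1_sig (constructive_indefinite_description _ (max_index_exists (good n) n (good0 n)))).
  assert (Hkap : forall n, good n (kap n) /\ forall j, good n j -> (j <= kap n)%nat).
  { intros n. unfold kap. destruct constructive_indefinite_description as [k [H1 H2]]. simpl.
    split; [exact H1|]. intros j Hj. apply H2; [apply Hj|exact Hj]. }
  (* A bound at every n, not just almost every n: goodness with i = 0 keeps the radius within 1 of
     that of [v O]. *)
  assert (Hbound : exists B, forall n, rad (v (kap n)) n <= B).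
  { destruct (rad_bound (v O)) as [B HB]. exists (B + 1). intros n. specialize (HB n).
    destruct (Hkap n) as [[_ H1] _]. specialize (H1 O (kap n) ltac:(lia) ltac:(lia)).
    pose proof (csq_ge_rad (v O) (v (kap n)) n) as H2. simpl (2 ^ 0) in H1.
    rewrite Rinv_1 in H1. nra. }
  set (l := ConeSeq (fun n => rad (v (kap n)) n) (fun n => dir (v (kap n)) n)
    (fun n => rad_ge0 (v (kap n)) n) Hbound).
  assert (Hl : forall k, cdist (v k) l <= / 2 ^ k).
  { intros k. apply cdist_le; [left; apply Rinv_0_lt_compat, pow_lt; lra|].
    apply (w_mono w w_ultra) with (1 := Hgood k). intros n Hn.
    destruct (Hkap n) as [[_ H1] H2]. left. apply (H1 k (kap n)); [apply H2; exact Hn|lia]. }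
  exists l. split; [exact I|]. intros e He.
  destruct (inv_INR_small 2 e He) as [k Hk]. specialize (Hk k (Nat.le_refl _)).
  exists (M k). intros n Hn.
  destruct (HM k n (M k) Hn (Nat.le_refl _)) as [_ H1]. fold (v k) in H1.
  pose proof (cdist_tri (u n) (v k) l). pose proof (Hl k). pose proof (inv_pow2_le k). lra.
Qed.

(** * The cone over [X] as a complete convex subcone *)

Definition cconst (r : R) (Hr : 0 <= r) (x : X) : cone_seq :=
  ConeSeq (fun _ => r) (fun _ => x) (fun _ => Hr)
    (ex_intro _ r (fun _ => Rle_refl r)).

(** Sequences are required to be literally constant, not just up to pseudodistance 0, so that radius
    and direction can be read off at any index. *)
Definition base_cone (u : cone_seq) : Prop :=
  exists r x, forall n, rad u n = r /\ dir u n = x.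

Lemma base_cone_const (r : R) (Hr : 0 <= r) (x : X) : base_cone (cconst r Hr x).
Proof. exists r, x. auto. Qed.

Lemma base_cone_convex : comb_convex cone_seq ccomb base_cone.
Proof.
  intros t u v _ [r [x Hu]] [s [y Hv]].
  exists (fst (cone_sum (Rabs (1 - t) * r) x (Rabs t * s) y)),
    (snd (cone_sum (Rabs (1 - t) * r) x (Rabs t * s) y)).
  intros n. simpl. destruct (Hu n) as [-> ->]. destruct (Hv n) as [-> ->]. auto.
Qed.

Lemma base_cone_scal (l : R) (u : cone_seq) : base_cone u -> base_cone (cscal l u).
Proof.
  intros [r [x Hu]]. exists (Rabs l * r), x. intros n. simpl. destruct (Hu n) as [-> ->]. auto.
Qed.

Lemma cdist_base (u v : cone_seq) (r s : R) (x y : X) :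
  (forall n, rad u n = r /\ dir u n = x) -> (forall n, rad v n = s /\ dir v n = y) ->
  cdist u v ^ 2 = (r - s) ^ 2 + 2 * (r * s) * (1 - cos (d x y)).
Proof.
  intros Hu Hv. apply (ulim_unique w w_ultra (csq u v)); [apply cdist_ulim|].
  apply (ulim_ext w w_ultra (fun _ => (r - s) ^ 2 + 2 * (r * s) * (1 - cos (d x y)))).
  - intros n. rewrite csq_eq. destruct (Hu n) as [-> ->]. destruct (Hv n) as [-> ->]. auto.
  - apply ulim_const. exact w_ultra.
Qed.

Lemma one_minus_cos_le (x : R) : 0 <= x -> 1 - cos x <= x ^ 2 / 2.
Proof.
  intros Hx. replace (cos x) with (cos (2 * (x / 2))) by (f_equal; field).
  rewrite cos_2a_sin.
  destruct (Rle_lt_or_eq_dec _ _ Hx) as [Hx'|<-].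
  2: { replace (0 / 2) with 0 by field. rewrite sin_0. lra. }
  assert (H1 : sin (x / 2) < x / 2) by (apply sin_lt_x; lra).
  assert (H2 : - (x / 2) < sin (x / 2)).
  { destruct (Rle_or_lt (x / 2) PI) as [H|H].
    - assert (0 <= sin (x / 2)) by (apply sin_ge_0; lra). lra.
    - pose proof (SIN_bound (x / 2)). pose proof PI2_1. lra. }
  nra.
Qed.

Lemma small_of_one_minus_cos (x e : R) : 0 <= x <= PI -> 0 < e <= PI ->
  1 - cos x < 1 - cos e -> x < e.
Proof.
  intros Hx He H. destruct (Rlt_or_le x e) as [|Hle]; [assumption|].
  assert (cos x <= cos e) by (apply cos_decr_1; lra). lra.
Qed.

(** The radii converge. If their limit is positive, the directions form a Cauchy sequence in [X]; if
    it is 0, the limit is the apex and [x0] is an arbitrary direction for it. *)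
Lemma base_cone_complete (x0 : X) : complete d -> complete_set cone_seq cdist base_cone.
Proof.
  intros Hcomp u Hu Hc. pose proof PI_RGT_0.
  set (r := fun m => rad (u m) O). set (x := fun m => dir (u m) O).
  assert (Hrx : forall m n, rad (u m) n = r m /\ dir (u m) n = x m).
  { intros m n. destruct (Hu m) as [s [y H1]]. unfold r, x.
    destruct (H1 O) as [-> ->]. apply H1. }
  assert (Hr0 : forall m, 0 <= r m) by (intros; apply rad_ge0).
  assert (Hd : forall m k, cdist (u m) (u k) ^ 2
      = (r m - r k) ^ 2 + 2 * (r m * r k) * (1 - cos (d (x m) (x k)))).
  { intros m k. apply cdist_base; auto. }
  assert (Hpos : forall m k, 0 <= 2 * (r m * r k) * (1 - cos (d (x m) (x k)))).
  { intros m k. pose proof (COS_bound (d (x m) (x k))).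
    apply Rmult_le_pos; [|lra]. pose proof (Hr0 m). pose proof (Hr0 k). nra. }
  destruct (R_complete r) as [rr Hrr].
  { intros e He. destruct (Hc e He) as [N HN]. exists N. intros m k Hm Hk.
    specialize (HN m k Hm Hk). specialize (Hd m k). specialize (Hpos m k).
    unfold Rdist. pose proof (cdist_ge0 (u m) (u k)). apply Rabs_def1; nra. }
  assert (Hconv : forall e, 0 < e -> exists N, forall m, (N <= m)%nat -> Rabs (r m - rr) < e).
  { intros e He. destruct (Hrr e He) as [N HN]. exists N. intros m Hm. apply HN. lia. }
  assert (Hrr0 : 0 <= rr).
  { apply Rle_of_eps with (c := 1). intros e He. destruct (Hconv e He) as [N HN].
    specialize (HN N (Nat.le_refl _)). apply Rabs_def2 in HN. pose proof (Hr0 N). lra. }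
  destruct (Rle_lt_or_eq_dec _ _ Hrr0) as [Hrpos|Hrzero].
  - assert (Hx : cauchy_seq d x).
    { intros e0 He0. set (e := Rmin e0 PI).
      assert (He : 0 < e <= PI) by (unfold e; split; [apply Rmin_glb_lt; lra|apply Rmin_r]).
      assert (Hce : 0 < 1 - cos e).
      { assert (cos e < cos 0) by (apply cos_decreasing_1; lra). rewrite cos_0 in *. lra. }
      (* Once both radii exceed rr / 2, the squared distance is at least rr^2 / 2 times 1 - cos of
         the angle. *)
      set (c := rr * rr / 2 * (1 - cos e)).
      assert (Hcpos : 0 < c) by (unfold c; apply Rmult_lt_0_compat; nra).
      destruct (Hc (sqrt c) (sqrt_lt_R0 _ Hcpos)) as [N1 HN1].
      destruct (Hconv (rr / 2) ltac:(lra)) as [N2 HN2].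
      exists (max N1 N2). intros m k Hm Hk.
      specialize (HN1 m k ltac:(lia) ltac:(lia)).
      pose proof (HN2 m ltac:(lia)) as A1. pose proof (HN2 k ltac:(lia)) as A2.
      apply Rabs_def2 in A1. apply Rabs_def2 in A2.
      apply Rlt_le_trans with e; [|apply Rmin_l].
      apply small_of_one_minus_cos; [split; [apply d_ge0|apply d_le_PI]|exact He|].
      assert (Hq : cdist (u m) (u k) ^ 2 < c).
      { pose proof (cdist_ge0 (u m) (u k)). pose proof (sqrt_sqrt c ltac:(lra)). nra. }
      rewrite Hd in Hq. pose proof (pow2_ge_0 (r m - r k)).
      assert (Hrr4 : rr * rr / 4 <= r m * r k) by nra.
      pose proof (COS_bound (d (x m) (x k))).
      assert (H2 : rr * rr / 2 * (1 - cos (d (x m) (x k))) < rr * rr / 2 * (1 - cos e)).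
      { fold c. assert (rr * rr / 2 * (1 - cos (d (x m) (x k)))
          <= 2 * (r m * r k) * (1 - cos (d (x m) (x k)))) by nra. lra. }
      apply Rmult_lt_reg_l in H2; [exact H2|nra]. }
    destruct (Hcomp x Hx) as [xx Hxx].
    exists (cconst rr Hrr0 xx). split; [apply base_cone_const|].
    intros e He.
    destruct (Hconv (e / 2) ltac:(lra)) as [N1 HN1].
    assert (He2 : 0 < e / 2 / rr) by (apply Rdiv_lt_0_compat; lra).
    destruct (Hxx _ He2) as [N2 HN2].
    exists (max N1 N2). intros m Hm. specialize (HN1 m ltac:(lia)). specialize (HN2 m ltac:(lia)).
    set (v := cconst rr Hrr0 (x m)).
    assert (D1 : cdist (u m) v < e / 2).
    { pose proof (cdist_base (u m) v (r m) rr (x m) (x m) (Hrx m) (fun _ => conj eq_refl eq_refl)) as E.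
      rewrite d_refl, cos_0 in E. apply Rabs_def2 in HN1.
      pose proof (cdist_ge0 (u m) v). nra. }
    assert (D2 : cdist v (cconst rr Hrr0 xx) < e / 2).
    { pose proof (cdist_base v (cconst rr Hrr0 xx) rr rr (x m) xx
        (fun _ => conj eq_refl eq_refl) (fun _ => conj eq_refl eq_refl)) as E.
      pose proof (one_minus_cos_le _ (d_ge0 (x m) xx)) as H1.
      pose proof (d_ge0 (x m) xx) as H2.
      assert (H3 : cdist v (cconst rr Hrr0 xx) <= rr * d (x m) xx).
      { apply le_of_sqr_le; [nra|]. rewrite E. nra. }
      assert (H4 : rr * d (x m) xx < rr * (e / 2 / rr)) by (apply Rmult_lt_compat_l; auto).
      replace (rr * (e / 2 / rr)) with (e / 2) in H4 by (field; lra). lra. }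
    pose proof (cdist_tri (u m) v (cconst rr Hrr0 xx)). lra.
  - exists (cconst rr Hrr0 x0). split; [apply base_cone_const|].
    intros e He. destruct (Hconv e He) as [N HN]. exists N. intros m Hm. specialize (HN m Hm).
    pose proof (cdist_base (u m) (cconst rr Hrr0 x0) (r m) rr (x m) x0
      (Hrx m) (fun _ => conj eq_refl eq_refl)) as E.
    assert (E0 : cdist (u m) (cconst rr Hrr0 x0) ^ 2 = r m ^ 2)
      by (rewrite E, <- Hrzero; ring).
    apply Rabs_def2 in HN.
    pose proof (cdist_ge0 (u m) (cconst rr Hrr0 x0)). nra.
Qed.

(** * Unit vectors and the retraction of the ultracompletion *)

Definition cunit (x : nat -> X) : cone_seq :=
  ConeSeq (fun _ => 1) x (fun _ => Rle_0_1) (ex_intro (fun B => nat -> 1 <= B) 1 (fun _ => Rle_refl 1)).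

Lemma cip_cunit (x : nat -> X) : cip (cunit x) (cunit x) = 1.
Proof.
  apply cip_eq. apply (ulim_ext w w_ultra (fun _ => 1)).
  - intros n. rewrite cker_diag. simpl. ring.
  - apply ulim_const. exact w_ultra.
Qed.

Lemma cdist_cunit (x y : nat -> X) (L : R) : ulim w (fun n => d (x n) (y n)) L ->
  cdist (cunit x) (cunit y) ^ 2 = 2 - 2 * cos L.
Proof.
  intros H. rewrite cdist_sq, !cip_cunit.
  replace (cip (cunit x) (cunit y)) with (cos L); [ring|].
  symmetry. apply cip_eq. apply (ulim_ext w w_ultra (fun n => cos (d (x n) (y n)))).
  - intros n. unfold cker. simpl. ring.
  - apply ulim_comp; [exact w_ultra|apply continuity_cos|exact H].
Qed.

Lemma cip_ge0 (u v : cone_seq) : (forall n, d (dir u n) (dir v n) <= PI / 2) -> 0 <= cip u v.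
Proof.
  intros H. apply (ulim_le w w_ultra (fun _ => 0) (cker u v)).
  - apply ulim_const. exact w_ultra.
  - apply cip_ulim.
  - apply w_all; [exact w_ultra|]. intros n. unfold cker.
    apply Rmult_le_pos; [apply Rmult_le_pos; apply rad_ge0|].
    pose proof PI_RGT_0. pose proof (d_ge0 (dir u n) (dir v n)). specialize (H n).
    apply cos_ge_0; lra.
Qed.

(** On unit vectors the squared distance is 2 - 2 cos of the angle, increasing on [0, PI]; a short
    map between unit vectors of the cones is thus short for the angles. *)
Lemma short_retraction_exists (p : X) : complete d -> (forall x, d p x <= PI / 2) ->
  exists f, short_retraction d w f.
Proof.
  intros Hcomp Hp. pose proof PI_RGT_0.
  set (ph := cunit (fun _ => p)).
  assert (ph_base : base_cone ph) by (exists 1, p; auto).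
  (* The bound PI / 2 enters here: every vector of the large cone satisfies the condition defining
     the initial wedge. *)
  assert (ip_ge0 : forall u, 0 <= cip u ph).
  { intros u. apply cip_ge0. intros n. rewrite d_sym. apply Hp. }
  destruct (projection_exists cone_seq cdist ccomb cdist_ge0 cdist_tri ccomb_npc base_cone
    (ex_intro _ ph ph_base) base_cone_convex (base_cone_complete p Hcomp)) as [PU HPU].
  destruct (cone_retraction cone_seq cdist ccomb cdist_ge0 cdist_sym cdist_refl cdist_tri
    ccomb_npc cip cscal base_cone ph cip_sym cdist_sq cip_scal cip_comb cone_seq_complete
    base_cone_convex (fun l v _ => base_cone_scal l v) ph_base (cip_cunit _)
    (fun v _ => ip_ge0 v) PU HPU) as [F [HF1 [HF2 HF3]]].
  set (f := fun x => dir (F (cunit x)) O).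
  assert (Hf : forall x n, rad (F (cunit x)) n = 1 /\ dir (F (cunit x)) n = f x).
  { intros x n. destruct (HF1 (cunit x) (ip_ge0 _) (cip_cunit x)) as [[r [y Hb]] Hn].
    assert (Er : r ^ 2 = 1).
    { rewrite <- Hn. symmetry. apply cip_eq. apply (ulim_ext w w_ultra (fun _ => r ^ 2)).
      - intros k. rewrite cker_diag. destruct (Hb k) as [-> _]. reflexivity.
      - apply ulim_const. exact w_ultra. }
    unfold f. destruct (Hb O) as [E1 ->]. destruct (Hb n) as [-> ->].
    pose proof (rad_ge0 (F (cunit x)) O). split; [nra|reflexivity]. }
  exists f. split.
  - intros x y L HL.
    assert (HL0 : 0 <= L).
    { apply (ulim_le w w_ultra (fun _ => 0) (fun n => d (x n) (y n))); auto.
      - apply ulim_const. exact w_ultra.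
      - apply w_all; [exact w_ultra|]. intros; apply d_ge0. }
    pose proof (HF2 _ _ (ip_ge0 (cunit x)) (cip_cunit x) (ip_ge0 (cunit y)) (cip_cunit y)) as H1.
    pose proof (cdist_cunit x y L HL) as H2.
    pose proof (cdist_base _ _ 1 1 (f x) (f y) (Hf x) (Hf y)) as H3.
    pose proof (cdist_ge0 (F (cunit x)) (F (cunit y))).
    assert (H4 : cos L <= cos (d (f x) (f y))) by nra.
    destruct (Rle_or_lt (d (f x) (f y)) L) as [|Hlt]; [assumption|exfalso].
    pose proof (d_le_PI (f x) (f y)).
    assert (cos (d (f x) (f y)) < cos L) by (apply cos_decreasing_1; lra). lra.
  - intros x.
    assert (Hb : base_cone (cunit (fun _ => x))) by (exists 1, x; auto).
    pose proof (HF3 _ Hb (cip_cunit _)) as H1.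
    pose proof (cdist_base (cunit (fun _ => x)) _ 1 1 x _ (fun _ => conj eq_refl eq_refl)
      (Hf (fun _ => x))) as H2.
    rewrite H1 in H2. symmetry. apply d_met.
    destruct (Rle_or_lt (d x (f (fun _ => x))) 0) as [Hle|Hlt].
    + pose proof (d_ge0 x (f (fun _ => x))). lra.
    + pose proof (d_le_PI x (f (fun _ => x))).
      assert (cos (d x (f (fun _ => x))) < cos 0) by (apply cos_decreasing_1; lra).
      rewrite cos_0 in *. lra.
Qed.

End CAT1Cone.

Theorem theorem1p3 (X : Type) (d : X -> X -> R)
  (Hmet : is_metric d) (Hcomplete : complete d)
  (Hlength : length_space d) (Hcat : CAT1 d)
  (p : X) (Hp : forall x : X, d p x <= PI / 2) :
  one_complemented d.
Proof.
  destruct nonprincipal_ultrafilter_exists as [w [Hw Hnp]].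
  exists w. split; [exact Hw|]. split; [exact Hnp|].
  apply short_retraction_exists with p; auto.
  intros x y. destruct Hmet as [_ [_ [Hsym Htri]]].
  pose proof (Htri x p y). rewrite (Hsym x p) in *. pose proof (Hp x). pose proof (Hp y). lra.
Qed.
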